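(* Let $A$ be a stratified set which has the right lifting property with respect to every inner elementary anodyne extension except possibly $\Delta^1[2]'\subseteq\Delta^1[2]''$. Suppose that the thin $1$-simplices of $A$ are exactly the $1$-simplices $v$ for which there exists a stratified map $f:\mathrm{th}_1(\tilde E_2)\to A$ with $f(e^-_1)=v$. Then $A$ is a weak complicial set.
   Context: A stratified set is a simplicial set with a set of thin simplices containing every degenerate simplex and no $0$-simplex; stratified maps preserve thinness. For $n\ge1$, $0\le k\le n$: $\Delta^k[n]$ is $\Delta[n]$ with $\alpha:[r]\to[n]$ thin iff degenerate or $\mathrm{im}(\alpha)\supseteq\{k-1,k,k+1\}\cap[n]$; $\Lambda^k[n]$ is the regular subset (thin simplices those thin in $\Delta^k[n]$) of $\alpha$ with $\mathrm{im}(\alpha)\cup\{k\}\ne[n]$; $\Delta^k[n]'$ (resp. $\Delta^k[n]''$) is $\Delta^k[n]$ with additionally the $(n-1)$-faces $\delta_i$, $i\ne k$ (resp. all $(n-1)$-faces) thin. Elementary anodyne extensions: $\Lambda^k[n]\subseteq\Delta^k[n]$ ($n\ge1$) and $\Delta^k[n]'\subseteq\Delta^k[n]''$ ($n\ge2$); inner if $0<k<n$. A weak complicial set is a stratified set with the right lifting property against all elementary anodyne extensions. $E$ is the simplicial set whose $m$-simplices are arbitrary functions $[m]\to\{-,+\}$ (words), operators acting by precomposition; $e^-_1$ is the $1$-simplex $-+$; $E_2$ is the simplicial subset of $E$ generated by the $2$-simplices $-+-$ and $+-+$; $\tilde E_2$ is its underlying simplicial set with only degenerate simplices thin; $\mathrm{th}_1(\tilde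 E_2)$ is $\tilde E_2$ with all simplices of dimension $>1$ made thin. *)

(* Defs.v *)
From HB Require Import structures.
From mathcomp Require Import all_boot.

Set Implicit Arguments.
Unset Strict Implicit.
Unset Printing Implicit Defensive.

(** * Simplicial operators: monotone maps [m] -> [n], with [n] = 'I_n.+1 *)

Definition monob (m n : nat) (f : {ffun 'I_m.+1 -> 'I_n.+1}) : bool :=
  [forall i : 'I_m.+1, forall j : 'I_m.+1, (i <= j) ==> (f i <= f j)].

Record hom (m n : nat) := Hom { hfun :> {ffun 'I_m.+1 -> 'I_n.+1}; hmono : monob hfun }.

Lemma hom_eq m n (a b : hom m n) : hfun a = hfun b -> a = b.
Proof.
case: a b => f p [g q] /= E; subst g; congr Hom; exact: bool_irrelevance.
Qed.

Lemma monob_id n : monob [ffun i : 'I_n.+1 => i].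
Proof.
by apply/forallP => i; apply/forallP => j; rewrite !ffunE; apply/implyP.
Qed.

Definition idh n : hom n n := Hom (monob_id n).

Lemma monob_comp l m n (b : hom m n) (a : hom l m) :
  monob [ffun i : 'I_l.+1 => b (a i)].
Proof.
apply/forallP => i; apply/forallP => j; rewrite !ffunE; apply/implyP => ij.
have /forallP/(_ i)/forallP/(_ j)/implyP/(_ ij) := hmono a.
move=> aij.
by have /forallP/(_ (a i))/forallP/(_ (a j))/implyP/(_ aij) := hmono b.
Qed.

Definition comph l m n (b : hom m n) (a : hom l m) : hom l n := Hom (monob_comp b a).

Record sset := SSet {
  sobj :> nat -> Type;
  sact : forall m n, hom m n -> sobj n -> sobj m;
  sact_id : forall n (x : sobj n), sact (idh n) x = x;
  sact_comp : forall l m n (a : hom l m) (b : hom m n) (x : sobj n),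
      sact (comph b a) x = sact a (sact b x) }.

Arguments sact {s m n} _ _.

Definition degenerate (X : sset) n (x : X n) : Prop :=
  exists m (al : hom n m) (y : X m), m < n /\ x = sact al y.

Definition natural (X Y : sset) (f : forall n, X n -> Y n) : Prop :=
  forall m n (al : hom m n) (x : X n), f m (sact al x) = sact al (f n x).

Definition pnatural (X Y : sset) (P : forall n, X n -> Prop)
    (g : forall n (x : X n), P n x -> Y n) : Prop :=
  forall m n (al : hom m n) (x : X n) (p : P n x) (q : P m (sact al x)),
    g m (sact al x) q = sact al (g n x p).

Record strat := Strat {
  sset_of :> sset;
  thin : forall n, sset_of n -> Prop;
  thin_degen : forall n (x : sset_of n), degenerate x -> thin x;
  thin0 : forall x : sset_of 0, ~ thin x }.

Arguments thin {s n} _.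

(** Right lifting property of A against the stratified inclusion
    (P, Tsub) ⊆ (V, Tbig): P a simplicial subset of V, Tsub its thin
    simplices, Tbig the thin simplices of V.  Every stratified map from the
    subset to A extends to a stratified map from V to A. *)
Definition rlp (A : strat) (V : sset) (P : forall n, V n -> Prop)
    (Tsub Tbig : forall n, V n -> Prop) : Prop :=
  forall g : forall n (x : V n), P n x -> A n,
    pnatural g ->
    (forall n (x : V n) (p : P n x), Tsub n x -> thin (g n x p)) ->
    exists f : forall n, V n -> A n,
      [/\ natural f,
          (forall n (x : V n), Tbig n x -> thin (f n x)) &
          (forall n (x : V n) (p : P n x), f n x = g n x p)].

Lemma Delta_id N n (x : hom n N) : comph x (idh n) = x.
Proof. by apply: hom_eq; apply/ffunP => i; rewrite !ffunE. Qed.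

Lemma Delta_comp N l m n (a : hom l m) (b : hom m n) (x : hom n N) :
  comph x (comph b a) = comph (comph x b) a.
Proof. by apply: hom_eq; apply/ffunP => i; rewrite !ffunE. Qed.

Definition Delta (N : nat) : sset :=
  @SSet (fun m => hom m N) (fun m n al x => comph x al)
        (@Delta_id N) (@Delta_comp N).

Definition thinDk (n k : nat) m (al : Delta n m) : Prop :=
  degenerate al \/
  (forall j : 'I_n.+1, k.-1 <= j <= k.+1 -> exists i, al i = j).
(* note: for k = 0, k.-1 = 0 and {-1,0,1} ∩ [n] = {0,1}, as intended *)

Definition hornP (n k : nat) m (al : Delta n m) : Prop :=
  exists j : 'I_n.+1, (j : nat) != k /\ forall i, al i != j.

Definition isface (n i : nat) m (al : Delta n m) : Prop :=
  m.+1 = n /\ forall l : 'I_m.+1, (al l : nat) = bump i l.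

Definition thinDk' (n k : nat) m (al : Delta n m) : Prop :=
  thinDk k al \/ exists i, [/\ i <= n, i != k & isface i al].

Definition thinDk'' (n k : nat) m (al : Delta n m) : Prop :=
  thinDk k al \/ exists i, i <= n /\ isface i al.

Definition rlp_horn (A : strat) (n k : nat) : Prop :=
  rlp A (@hornP n k) (@thinDk n k) (@thinDk n k).

Definition rlp_thin (A : strat) (n k : nat) : Prop :=
  rlp A (V := Delta n) (fun _ _ => True) (@thinDk' n k) (@thinDk'' n k).

Definition weak_complicial (A : strat) : Prop :=
  (forall n k, 1 <= n -> k <= n -> rlp_horn A n k) /\
  (forall n k, 2 <= n -> k <= n -> rlp_thin A n k).

(** * The simplicial set E of words; '-' = false, '+' = true *)

Definition Eact m n (al : hom m n) (w : {ffun 'I_n.+1 -> bool}) :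
  {ffun 'I_m.+1 -> bool} := [ffun i => w (al i)].

Lemma Eact_id n (w : {ffun 'I_n.+1 -> bool}) : Eact (idh n) w = w.
Proof. by apply/ffunP => i; rewrite !ffunE. Qed.

Lemma Eact_comp l m n (a : hom l m) (b : hom m n) (w : {ffun 'I_n.+1 -> bool}) :
  Eact (comph b a) w = Eact a (Eact b w).
Proof. by apply/ffunP => i; rewrite !ffunE. Qed.

Definition E : sset := @SSet (fun m => {ffun 'I_m.+1 -> bool}) Eact Eact_id Eact_comp.

Definition w_mpm : E 2 := [ffun i : 'I_3 => (i : nat) == 1].
Definition w_pmp : E 2 := [ffun i : 'I_3 => (i : nat) != 1].
Definition e1m : E 1 := [ffun i : 'I_2 => (i : nat) == 1].

Definition inE2 m (w : E m) : Prop :=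
  exists al : hom m 2, w = sact al w_mpm \/ w = sact al w_pmp.

Definition degenE2 m (w : E m) : Prop :=
  exists l (al : hom m l) (y : E l), [/\ l < m, inE2 y & w = sact al y].

Definition thin_th1E2 m (w : E m) : Prop := 1 < m \/ degenE2 w.

(* Main.v *)
From Stdlib Require Import ClassicalEpsilon.
Require Import Defs.
From mathcomp Require Import all_boot.
From mathcomp Require Import zify.

Set Implicit Arguments.
Unset Strict Implicit.
Unset Printing Implicit Defensive.

(** By duality only the outer extensions at [k = 0] matter, besides the 2-of-3 property
    of thin edges.  The latter is the usual argument for equivalences in a quasi-category:
    thin 2-simplices play the role of commuting triangles, and thin edges are exactly
    the invertible ones.

    Consider a horn in [Delta d.+2] missing the face opposite to [0], whose edge [01] is
    thin, hence a map out of [E_2].  Work in [Delta d.+4], whose first four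
    vertices ("letters") spell the word [-+-+] and whose other vertices are [2 .. d.+2] of
    the horn.  Letters [0] and [2] are copies of vertex [0], letters [1] and [3] are copies
    of vertex [1].  The horn, pulled back along degeneracies, and the map out of [E_2] define
    a map on a subcomplex; it extends by inner horns only, first to [123] (a right inverse),
    then to [012] and [0123] (a homotopy between the two candidate edges [01] and [03]), each
    joined with proper faces of the remaining vertices.  Lifting [12], then [01], over the
    full set of remaining vertices transports the given face at letter [0] to letter [1];
    a last inner horn on [013] transports it from [01] to [03], which is the original edge.
    Simplices with at least two letters stay thin throughout. *)

(** * Monotone maps and families of simplices *)

Lemma homP m n (a b : hom m n) : (forall i, (a i : nat) = b i) -> a = b.
Proof. by move=> e; apply: hom_eq; apply/ffunP => i; apply: val_inj; rewrite /= e. Qed.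

Lemma hom_le m n (al : hom m n) (i j : 'I_m.+1) : i <= j -> al i <= al j.
Proof. by move=> ij; have /forallP/(_ i)/forallP/(_ j)/implyP/(_ ij) := hmono al. Qed.

Lemma hom_le2 m n n' (al : hom m n) (be : hom m n') i j :
  (al i <= al j /\ be i <= be j) \/ (al j <= al i /\ be j <= be i).
Proof.
by have [ij|/ltnW ij] := leqP i j; [left|right]; split; apply: hom_le.
Qed.

Lemma comphE l m n (b : hom m n) (a : hom l m) i : comph b a i = b (a i).
Proof. by rewrite ffunE. Qed.

Lemma idhE n i : idh n i = i.
Proof. by rewrite ffunE. Qed.

Lemma comphA k l m n (c : hom m n) (b : hom l m) (a : hom k l) :
  comph (comph c b) a = comph c (comph b a).
Proof. by apply: homP => i; rewrite !comphE. Qed.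

Lemma comph_idl m n (a : hom m n) : comph (idh n) a = a.
Proof. by apply: homP => i; rewrite comphE idhE. Qed.

Lemma comph_idr m n (a : hom m n) : comph a (idh m) = a.
Proof. by apply: homP => i; rewrite comphE idhE. Qed.

Lemma mkh_subproof m n (f : nat -> nat) (fM : {homo f : i j / i <= j}) :
  monob [ffun i : 'I_m.+1 => inord (minn (f i) n) : 'I_n.+1].
Proof.
apply/forallP => i; apply/forallP => j; apply/implyP => /fM ij; rewrite !ffunE.
by rewrite !inordK ?ltnS ?geq_minr //; lia.
Qed.

(* The truncation [minn _ n] spares a bound on [f]. *)
Definition mkh m n (f : nat -> nat) (fM : {homo f : i j / i <= j}) : hom m n :=
  Hom (mkh_subproof m n fM).

Lemma mkhE m n (f : nat -> nat) (fM : {homo f : i j / i <= j}) i :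
  mkh m n fM i = minn (f i) n :> nat.
Proof. by rewrite /= ffunE inordK // ltnS geq_minr. Qed.

Lemma const_homo c : {homo (fun _ : nat => c) : i j / i <= j}.
Proof. by []. Qed.

Lemma id_homo : {homo (fun i : nat => i) : i j / i <= j}.
Proof. by []. Qed.

Lemma bump_homo i : {homo bump i : j k / j <= k}.
Proof. by move=> j k; rewrite leq_bump2. Qed.

Lemma unbump_homo i : {homo unbump i : j k / j <= k}.
Proof. by move=> j k; rewrite /unbump; lia. Qed.

Definition face n i : hom n n.+1 := mkh n n.+1 (bump_homo i).
Definition dege n i : hom n.+1 n := mkh n.+1 n (unbump_homo i).

Lemma faceE n i (j : 'I_n.+1) : face n i j = bump i j :> nat.
Proof. rewrite mkhE; have := ltn_ord j; rewrite /bump; lia. Qed.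

Lemma degeE n i (j : 'I_n.+2) : i <= n -> dege n i j = unbump i j :> nat.
Proof. rewrite mkhE; have := ltn_ord j; rewrite /unbump; lia. Qed.

Lemma face_dege m n i (al : hom m n.+1) :
  i <= n.+1 -> (forall l, (al l : nat) <> i) -> comph (face n i) (comph (dege n i) al) = al.
Proof.
move=> le_in ali; apply: homP => l; rewrite !comphE faceE mkhE.
have := ali l; have := ltn_ord (al l); rewrite /bump /unbump; lia.
Qed.

Definition im m n (al : hom m n) : {set 'I_n.+1} := [set al i | i in 'I_m.+1].

Lemma imP m n (al : hom m n) j : reflect (exists i, al i = j) (j \in im al).
Proof.
apply: (iffP imsetP) => [[i _ ->]|[i <-]]; first by exists i.
by exists i.
Qed.

Lemma in_im m n (al : hom m n) i : al i \in im al.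
Proof. by apply/imP; exists i. Qed.

Lemma im_comph l m n (b : hom m n) (a : hom l m) : im (comph b a) \subset im b.
Proof. by apply/subsetP => j /imP[i <-]; rewrite comphE in_im. Qed.

Lemma im_subP m n (al : hom m n) (S : {set 'I_n.+1}) :
  reflect (forall i, al i \in S) (im al \subset S).
Proof.
apply: (iffP subsetP) => [h i|h j /imP[i <-]//]; exact/h/in_im.
Qed.

(** The composite of [dege m i] and [face m i] moves only [i], to [i.+1], and monotonicity traps
    [al i.+1] between [al i] and [al j]. *)
Lemma noninj_factor m n (al : hom m n) (i j : 'I_m.+1) :
  i < j -> al i = al j ->
  exists m' (s : hom m m') (d : hom m' m), m' < m /\ comph (comph al d) s = al.
Proof.
case: m al i j => [|m] al i j ij e; first by have := ltn_ord j; lia.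
exists m, (dege m i), (face m i); split=> //.
apply: homP => l; rewrite !comphE.
have [il|il] := eqVneq (l : nat) i; last first.
  congr (nat_of_ord (al _)); apply: val_inj; rewrite /= faceE degeE; last by have := ltn_ord j; lia.
  by rewrite /bump /unbump; lia.
have -> : l = i by apply: val_inj.
have h : face m i (dege m i i) = i.+1 :> nat.
  rewrite faceE degeE; last by have := ltn_ord j; lia.
  by rewrite /bump /unbump; lia.
apply/eqP; rewrite eqn_leq; apply/andP; split; last by apply: hom_le; rewrite h.
by rewrite e; apply: hom_le; rewrite h.
Qed.

Lemma inj_strict m n (al : hom m n) : injective al ->
  forall i j : 'I_m.+1, i < j -> al i < al j.
Proof.
move=> alI i j ij; rewrite ltn_neqAle hom_le ?andbT 1?ltnW //.
by apply/eqP => /val_inj/alI e; rewrite e ltnn in ij.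
Qed.

Lemma strict_ge m n (al : hom m n) : injective al -> forall i : 'I_m.+1, i <= al i.
Proof.
move=> alI [i]; elim: i => [//|i IH] im1.
have im0 : i < m.+1 by lia.
have := IH im0; have := @inj_strict _ _ _ alI (Ordinal im0) (Ordinal im1) (ltnSn i).
by rewrite /=; lia.
Qed.

Lemma inj_endo_id m (al : hom m m) : injective al -> al = idh m.
Proof.
move=> alI; apply: homP => i; rewrite idhE.
suff h : forall d (j : 'I_m.+1), j + d = m -> al j <= j.
  apply/eqP; rewrite eqn_leq strict_ge // andbT.
  by apply: (h (m - i)); have := ltn_ord i; lia.
elim=> [|d IH] j jd; first by have := ltn_ord (al j); lia.
have j1 : j.+1 < m.+1 by lia.
have /= := IH (Ordinal j1); have /= := @inj_strict _ _ _ alI j (Ordinal j1) (ltnSn j).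
lia.
Qed.

Lemma non_injective m n (al : hom m n) :
  ~ injective al -> exists i j : 'I_m.+1, i < j /\ al i = al j.
Proof.
move=> nI; have /injectivePn [i [j ij e]] : ~~ injectiveb al by apply/injectiveP.
have [lt|lt] : i < j \/ j < i by move: ij; rewrite -val_eqE /=; lia.
- by exists i, j.
- by exists j, i.
Qed.

Lemma injectiveE m n (al : hom m n) : injective al -> #|im al| = m.+1.
Proof. by move=> alI; rewrite card_imset // card_ord. Qed.

Lemma inj_surj_dim m n (al : hom m n) :
  injective al -> (forall j, j \in im al) -> m = n.
Proof.
move=> alI alS; have := injectiveE alI.
have -> : im al = setT by apply/setP => j; rewrite inE alS.
by rewrite cardsT card_ord; lia.
Qed.

Definition family (A : sset) N := forall m, hom m N -> A m.

(* A family on the simplices of [Delta N] that is a simplicial map on those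
   whose image satisfies [K]; elsewhere its values are junk. *)
Definition nat_on (A : sset) N (K : {set 'I_N.+1} -> bool) (g : family A N) : Prop :=
  forall m n (be : hom m n) (al : hom n N),
    K (im al) -> g m (comph al be) = sact be (g n al).

Definition agree_on (A : sset) N (K : {set 'I_N.+1} -> bool) (g g' : family A N) : Prop :=
  forall m (al : hom m N), K (im al) -> g m al = g' m al.

Definition down_closed N (K : {set 'I_N.+1} -> bool) : Prop :=
  forall R R' : {set 'I_N.+1}, R' \subset R -> K R -> K R'.

Lemma thin_noninj (A : strat) N K (g : family A N) m (al : hom m N) :
  down_closed K -> nat_on K g -> K (im al) -> ~ injective al -> thin (g m al).
Proof.
move=> dc gn Kal /non_injective[i [j [ij e]]].
have [m' [s [d [lt es]]]] := noninj_factor ij e.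
apply: thin_degen; exists m', s, (g m' (comph al d)); split=> //.
by rewrite -gn ?es //; apply: dc Kal; apply: im_comph.
Qed.

Lemma nat_on_sact (A : sset) N n (x : A n) (r : hom N n) K :
  nat_on K (fun m (al : hom m N) => sact (comph r al) x).
Proof. by move=> m l be al _; rewrite -sact_comp comphA. Qed.

Lemma thin_sact_noninj (A : strat) m n (al : hom m n) (x : A n) :
  ~ injective al -> thin (sact al x).
Proof.
move=> nI; rewrite -[al]comph_idl.
exact: (thin_noninj (K := xpredT) _ (nat_on_sact x (idh n) (K := _))).
Qed.

Lemma thin_sact_surj (A : strat) m n (al : hom m n) (x : A n) :
  thin x -> (forall j, j \in im al) -> thin (sact al x).
Proof.
move=> xt alS; case: (excluded_middle_informative (injective al)) => [alI|]; last first.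
  exact: thin_sact_noninj.
have mn := inj_surj_dim alI alS; subst n.
by rewrite (inj_endo_id alI) sact_id.
Qed.

Lemma thin_sact_face (A : strat) m n i (q : hom m n.+1) (x : A n.+1) :
  i <= n.+1 -> thin (sact (face n i) x) ->
  (forall l, (q l : nat) <> i) -> (forall j : 'I_n.+2, (j : nat) <> i -> j \in im q) ->
  thin (sact q x).
Proof.
move=> le_in xt qi qj; rewrite -(face_dege le_in qi) sact_comp; apply: thin_sact_surj => // j.
have /imP[l e] : face n i j \in im q by apply: qj; rewrite faceE /bump; lia.
apply/imP; exists l; apply: ord_inj; rewrite comphE mkhE e faceE.
by have := ltn_ord j; rewrite /bump /unbump; lia.
Qed.

(** Naturality survives the case distinction because down-closedness keeps [comph al be] in
    whichever of the two complexes contains [al]. *)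
Lemma glue (A : sset) N K1 K2 (g1 g2 : family A N) :
  down_closed K1 -> down_closed K2 -> nat_on K1 g1 -> nat_on K2 g2 ->
  agree_on (fun R => K1 R && K2 R) g1 g2 ->
  exists g : family A N, [/\ nat_on (fun R => K1 R || K2 R) g,
    agree_on K1 g g1 & agree_on K2 g g2].
Proof.
move=> d1 d2 n1 n2 e.
pose g := (fun m al => if K1 (im al) then g1 m al else g2 m al) : family A N.
have e1 : agree_on K1 g g1 by move=> m al K; rewrite /g K.
have e2 : agree_on K2 g g2.
  by move=> m al K; rewrite /g; case: ifP => // K'; rewrite e // K' K.
exists g; split=> // m n be al /orP[] K.
- by rewrite !e1 ?n1 //; apply: d1 K; apply: im_comph.
- by rewrite !e2 ?n2 //; apply: d2 K; apply: im_comph.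
Qed.

(** * Horns, and lifting properties by the Yoneda lemma *)

Definition hornQ n k (R : {set 'I_n.+1}) : bool :=
  [exists j : 'I_n.+1, ((j : nat) != k) && (j \notin R)].

Lemma hornP_im n k m (al : Delta n m) : hornP k al <-> hornQ k (im al).
Proof.
split=> [[j [jk h]]|/existsP[j /andP[jk h]]].
  apply/existsP; exists j; rewrite jk; apply/imP => -[i e].
  by have := h i; rewrite e eqxx.
by exists j; split=> // i; apply: contraNneq h => <-; apply: in_im.
Qed.

Lemma hornQ_down n k : down_closed (@hornQ n k).
Proof.
move=> R R' /subsetP s /existsP[j /andP[jk h]]; apply/existsP; exists j.
by rewrite jk; apply: contraNN h; apply: s.
Qed.

Definition covers n k (R : {set 'I_n.+1}) : Prop :=
  forall j : 'I_n.+1, k.-1 <= j <= k.+1 -> j \in R.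

(* Yoneda forms of [rlp_horn] and [rlp_thin]. *)
Definition horn_fill (A : strat) n k : Prop :=
  forall h : family A n, nat_on (hornQ k) h ->
    (forall m (al : hom m n), hornQ k (im al) -> covers k (im al) -> thin (h m al)) ->
    exists x : A n,
      (forall m (al : hom m n), hornQ k (im al) -> sact al x = h m al) /\
      (forall m (al : hom m n), covers k (im al) -> thin (sact al x)).

Definition thin_fill (A : strat) n k : Prop :=
  forall x : A n,
    (forall m (al : hom m n), thinDk' k al -> thin (sact al x)) ->
    forall m (al : hom m n), isface k al -> thin (sact al x).

(** Families are total functions, whereas lifting problems give functions of a simplex and a
    membership proof. Off [P] the value is arbitrary; on [P] proof irrelevance makes it independent
    of the proof. *)
Lemma totalize (X Y : sset) (P : forall n, X n -> Prop)
    (g : forall n (x : X n), P n x -> Y n) :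
  (forall n, inhabited (Y n)) ->
  exists G : forall n, X n -> Y n, forall n x (p : P n x), G n x = g n x p.
Proof.
move=> inh.
pose D n : Y n := epsilon (inh n) (fun _ => True).
exists (fun n x => match excluded_middle_informative (P n x) with
                   | left p => g n x p | right _ => D n end).
move=> n x p; case: (excluded_middle_informative _) => [p'|//].
by congr g; apply: Classical_Prop.proof_irrelevance.
Qed.

Lemma degenerate_noninj N m (al : Delta N m) : degenerate al -> ~ injective (al : hom m N).
Proof.
move=> [m' [be [y [lt ->]]]] alI.
have beI : injective be by move=> i j e; apply: alI; rewrite /= !comphE e.
by have := max_card (im be); rewrite injectiveE // card_ord; lia.
Qed.

Lemma horn_fill_rlp (A : strat) n k : rlp_horn A n k -> horn_fill A n k.
Proof.
move=> H h hn ht.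
have [||f [fn ft fe]] := H (fun m x _ => h m x).
- by move=> m l al x p q; apply: hn; apply/hornP_im.
- move=> m x /hornP_im p [/degenerate_noninj|c].
    by apply: thin_noninj p; [apply: hornQ_down|].
  by apply: ht => // j /c /imP.
have fE m (al : hom m n) : sact al (f n (idh n)) = f m al.
  by rewrite -fn /= comph_idl.
exists (f n (idh n)); split=> m al; rewrite fE.
- by move=> /hornP_im p; rewrite (fe _ _ p).
- by move=> c; apply: ft; right=> j /c /imP.
Qed.

Lemma rlp_horn_fill (A : strat) n k : 0 < n -> k <= n -> horn_fill A n k -> rlp_horn A n k.
Proof.
move=> n0 kn H g gn gt.
(* The constant simplices at [k] lie in the horn, so every [A m] is inhabited, as [totalize]
   requires. *)
have hin m : hornP k (mkh m n (const_homo k) : Delta n m).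
  have [j [jn jk]] : exists j, j < n.+1 /\ j != k by case: (k) => [|?]; [exists 1|exists 0].
  exists (Ordinal jn); split=> // i; apply/eqP => /(congr1 (@nat_of_ord _)).
  by rewrite mkhE /=; lia.
have [G GE] := totalize g (fun m => inhabits (g m _ (hin m))).
have Gn : nat_on (hornQ k) G.
  move=> m l be al p; have p' := p; move/hornP_im in p'.
  have q : hornP k (sact be (al : Delta n l)).
    by apply/hornP_im; apply: hornQ_down p; apply: im_comph.
  by rewrite (GE _ _ p') (GE _ _ q) (gn _ _ _ _ p').
have [|x [xe xt]] := H G Gn.
  move=> m al /hornP_im p c; rewrite (GE _ _ p); apply: gt; right=> j /c /imP //.
exists (fun m (al : hom m n) => sact al x); split.
- by move=> m l be al; rewrite -sact_comp.
- move=> m al [/degenerate_noninj|c]; first exact: thin_sact_noninj.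
  by apply: xt => j /c /imP.
- by move=> m al p; rewrite -GE; apply: xe; apply/hornP_im.
Qed.

Lemma thin_fill_rlp (A : strat) n k : k <= n -> rlp_thin A n k -> thin_fill A n k.
Proof.
move=> kn H x xt m al alf.
have [||f [fn ft fe]] := H (fun m (al : hom m n) _ => sact al x).
- by move=> *; rewrite -sact_comp.
- by move=> ? ? _; apply: xt.
- by rewrite -(fe _ al I); apply: ft; right; exists k.
Qed.

Lemma rlp_thin_fill (A : strat) n k : thin_fill A n k -> rlp_thin A n k.
Proof.
move=> H g gn gt.
have gE m (al : hom m n) : sact al (g n (idh n) I) = g m al I.
  by rewrite -(gn _ _ _ _ _ I) /= comph_idl.
have gt' m (al : hom m n) : thinDk' k al -> thin (g m al I) by apply: gt.
exists (fun m (al : hom m n) => g m al I); split=> //.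
- move=> m al [d|[i [ile alf]]]; first by apply: gt'; left.
  have [ik|ik] := eqVneq i k; last by apply: gt'; right; exists i.
  subst i; rewrite -gE; apply: H alf => m' al' h.
  by rewrite gE; apply: gt'.
- by move=> m al []. 
Qed.

(** Gives the simplex spanned by [S] its own numbering: [io] includes it and [r] retracts the whole
    simplex onto it, so fillers of standard horns can be moved into [Delta N]. *)
Lemma set_section N (S : {set 'I_N.+1}) : S != set0 ->
  exists n (io : hom n N) (r : hom N n),
    [/\ #|S| = n.+1, forall i, r (io i) = i, {in S, forall j, io (r j) = j}
      & forall i, io i \in S].
Proof.
move=> S0; have [n cS] : exists n, #|S| = n.+1.
  by exists #|S|.-1; rewrite prednK // card_gt0.
(* [f i] is the rank of [i] in [S]. Above all of [S] it equals [n.+1], which [mkh] cuts down to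
   [n]. *)
pose f (i : nat) := #|[set s in S | (s : nat) < i]|.
have fM : {homo f : i j / i <= j}.
  move=> i j ij; apply: subset_leq_card; apply/subsetP => s; rewrite !inE.
  by case/andP=> -> /= si; apply: leq_trans ij.
have fS (i j : 'I_N.+1) : i \in S -> i < j -> f i < f j.
  move=> iS ij; apply: proper_card; apply/properP; split.
    by apply/subsetP => s; rewrite !inE => /andP[-> /= si]; apply: ltn_trans ij.
  by exists i; rewrite inE iS //= ltnn.
have fb (i : 'I_N.+1) : i \in S -> f i < n.+1.
  move=> iS; rewrite -cS; apply: proper_card; apply/properP; split.
    by apply/subsetP => s; rewrite inE => /andP[].
  by exists i; rewrite // inE ltnn andbF.
have fI (i j : 'I_N.+1) : i \in S -> j \in S -> f i = f j -> i = j.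
  move=> iS jS e; apply: val_inj; apply/eqP; rewrite eqn_leq /=.
  by apply/andP; split; rewrite leqNgt; apply/negP => /fS lt;
    [have := lt jS | have := lt iS]; rewrite e ltnn.
pose F (s : 'I_N.+1) : 'I_n.+1 := inord (f s).
have fsurj (i : 'I_n.+1) : exists s, (s \in S) && (f s == i).
  have : i \in F @: S.
    have -> : F @: S = setT.
      apply/eqP; rewrite eqEcard subsetT cardsT card_ord card_in_imset ?cS ?leqnn //.
      move=> s t sS tS /(congr1 (@nat_of_ord _)); rewrite /F !inordK ?fb //.
      exact: fI.
    by rewrite inE.
  by case/imsetP=> s sS ->; exists s; rewrite sS /F inordK ?fb //=.
pose iof i := xchoose (fsurj i).
have iofP i : iof i \in S /\ f (iof i) = i.
  by have /andP[? /eqP] := xchooseP (fsurj i).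
have ioM : monob (finfun iof).
  apply/forallP => i; apply/forallP => j; apply/implyP => ij; rewrite !ffunE.
  rewrite leqNgt; apply/negP => lt.
  have [iS ei] := iofP i; have [jS ej] := iofP j.
  by have := fS _ _ jS lt; rewrite ei ej; lia.
exists n, (Hom ioM), (mkh N n fM).
have ioE i : (Hom ioM) i = iof i by rewrite ffunE.
split=> //.
- move=> i; apply: ord_inj; rewrite mkhE ioE (proj2 (iofP i)).
  by have := ltn_ord i; lia.
- move=> j jS; have [iS e] := iofP (mkh N n fM j); rewrite ioE; apply: fI => //.
  by rewrite e mkhE; have := fb _ jS; lia.
- by move=> i; rewrite ioE; have [] := iofP i.
Qed.

(** * Filling inner horns inside a simplex *)

Section InnerHorns.
Variable A : strat.
Hypothesis Hhorn : forall n k, 0 < k < n -> horn_fill A n k.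
Hypothesis Hthin : forall n k, 2 < n -> 0 < k < n -> thin_fill A n k.

(** In the numbering of the simplex spanned by [S] these three become neighbours, the vertices that
    detect thinness in the inner extension at [k]. *)
Definition consecutive N (S : {set 'I_N.+1}) (a k b : 'I_N.+1) : Prop :=
  [/\ a \in S, k \in S, b \in S, a < k < b &
      forall s, s \in S -> a < s < b -> s = k].

Lemma section_consecutive N (S : {set 'I_N.+1}) a k b n (io : hom n N) (r : hom N n) :
  consecutive S a k b ->
  (forall i, r (io i) = i) -> {in S, forall j, io (r j) = j} -> (forall i, io i \in S) ->
  (r k = (r a).+1 :> nat) /\ (r b = (r k).+1 :> nat).
Proof.
move=> [aS kS bS /andP[ak kb] bet] rio ior ioS.
have st i j : i \in S -> j \in S -> i < j -> r i < r j.
  move=> iS jS ij; rewrite ltn_neqAle hom_le ?andbT 1?ltnW //.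
  apply/eqP => /val_inj e; move: ij.
  by rewrite -(ior i iS) e (ior j jS) ltnn.
have tsr i (j : 'I_n.+1) : i \in S -> r i < j -> i < io j.
  move=> iS ij; rewrite ltnNge; apply/negP => /(hom_le r); rewrite rio; lia.
have tsl i (j : 'I_n.+1) : i \in S -> j < r i -> io j < i.
  move=> iS ij; rewrite ltnNge; apply/negP => /(hom_le r); rewrite rio; lia.
(* A vertex strictly between [r a] and [r b] comes through [io] from a member of [S] strictly
   between [a] and [b], which is [k]. *)
have key (j : 'I_n.+1) : r a < j < r b -> j = r k.
  case/andP=> h1 h2; rewrite -(rio j); congr (r _).
  by apply: bet; rewrite ?ioS // tsr ?tsl.
have := st _ _ aS kS ak; have := st _ _ kS bS kb => h1 h2.
have lt_a : (r a).+1 < n.+1 by have := ltn_ord (r k); lia.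
have lt_k : (r k).+1 < n.+1 by have := ltn_ord (r b); lia.
have := key (Ordinal lt_a); have := key (Ordinal lt_k).
move=> /= e1 e2; split.
- by rewrite -e2 //= ltnSn /=; lia.
- have [//|ne] := eqVneq (r b : nat) (r k).+1.
  have := e1; rewrite (_ : r a < _ < _) => [/(_ isT)/(congr1 (@nat_of_ord _))/=|]; lia.
Qed.

(** This is the thinness extension for the simplex spanned by [S], in which [k] is an inner vertex.
    More than three vertices mean dimension at least 3, so the excluded extension
    $\Delta^1[2]'\subseteq\Delta^1[2]''$ is never called for. *)
Lemma thin_face N K (g : family A N) (S : {set 'I_N.+1}) a k b :
  down_closed K -> nat_on K g -> K S -> consecutive S a k b -> 3 < #|S| ->
  (forall m (al : hom m N), im al \subset S ->
     a \in im al -> k \in im al -> b \in im al -> thin (g m al)) ->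
  (forall j, j \in S -> j != k ->
     forall m (al : hom m N), im al = S :\ j -> thin (g m al)) ->
  forall m (al : hom m N), im al = S :\ k -> thin (g m al).
Proof.
move=> dc gn KS cons cS gt gf m al ial.
have [aS kS bS akb _] := cons.
have S0 : S != set0 by rewrite -card_gt0; lia.
have [[//|n] [io [r [eS rio ior ioS]]]] := set_section S0; first by lia.
have [rk rb] := section_consecutive cons rio ior ioS.
have imS m' (be : hom m' n.+1) : im (comph io be) \subset S.
  by apply/im_subP => i; rewrite comphE ioS.
have Kio : K (im io) by apply: dc KS; apply/im_subP.
pose x := g n.+1 io.
have xE m' (be : hom m' n.+1) : sact be x = g m' (comph io be) by rewrite gn.
have fact : comph io (comph r al) = al.
  apply: homP => i; rewrite !comphE ior //.
  by have := in_im al i; rewrite ial inE => /andP[].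
have alk i : r (al i) != r k.
  have := in_im al i; rewrite ial inE => /andP[/[!inE] ne iS].
  by apply: contraNneq ne => e; rewrite -(ior _ iS) e ior.
have rn : r b < n.+2 := ltn_ord _.
rewrite -fact -xE; apply: (thin_sact_face (i := r k)); first by rewrite -ltnS.
  apply: (Hthin (k := r k) (n := n.+1)); [lia|lia| |].
  - move=> m' be [[/degenerate_noninj|c]|[i [ile ik bef]]].
    + exact: thin_sact_noninj.
    + rewrite xE; apply: gt => //; apply/imP.
      * have [i e] := c (r a) ltac:(lia); exists i; by rewrite comphE e ior.
      * have [i e] := c (r k) ltac:(lia); exists i; by rewrite comphE e ior.
      * have [i e] := c (r b) ltac:(lia); exists i; by rewrite comphE e ior.
    + rewrite xE; have ilt : i < n.+2 by lia.
      apply: (gf (io (Ordinal ilt))) => //.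
        by apply/eqP => e; move: ik; rewrite -e rio eqxx.
      case: bef => /succn_inj m'n bef; subst m'.
      apply/setP => j; rewrite !inE; apply/imP/andP => [[l <-]|[ne jS]].
        rewrite comphE ioS; split=> //; apply/eqP => /(congr1 r); rewrite !rio.
        by move/(congr1 (@nat_of_ord _)); rewrite bef /= /bump; lia.
      have rji : (r j : nat) != i.
        by apply: contraNneq ne => e; apply/eqP; rewrite -(ior j jS); congr (io _); apply: ord_inj.
      have rjn := ltn_ord (r j).
      have lt : unbump i (r j) < n.+1 by clear -rjn rji ile; rewrite /unbump; lia.
      exists (Ordinal lt); rewrite comphE -[RHS](ior j jS); congr (io _).
      by apply: ord_inj; rewrite bef /= /bump /unbump; move: rji; clear; lia.
  - by split=> // l; rewrite faceE.
- by move=> l e; have /eqP := alk l; apply; apply: ord_inj; rewrite -e comphE.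
move=> j jk; have : io j \in im al.
  by rewrite ial !inE ioS andbT; apply/eqP => e; apply: jk; rewrite -e rio.
by case/imP=> i e; apply/imP; exists i; rewrite comphE e rio.
Qed.

Definition thin_on N (K Th : {set 'I_N.+1} -> bool) (g : family A N) : Prop :=
  forall m (al : hom m N), K (im al) -> Th (im al) -> thin (g m al).

(** The horn of [S] at [k] is moved to a standard simplex along [io], filled there, and the filler
    [x] is spread over [Delta N] by [r]. The simplices gained have image [S], which contains [a],
    [k], [b], or [S :\ k], where [thin_face] supplies the thinness. *)
Lemma fill_one N (K Th : {set 'I_N.+1} -> bool) (g : family A N) (S : {set 'I_N.+1}) a k b :
  down_closed K -> nat_on K g -> thin_on K Th g ->
  consecutive S a k b ->
  ~~ K (S :\ k) -> (forall j, j \in S -> j != k -> K (S :\ j)) ->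
  (forall R : {set 'I_N.+1}, a \in R -> k \in R -> b \in R -> Th R) ->
  (Th (S :\ k) -> 3 < #|S| /\ forall j, j \in S -> j != k -> Th (S :\ j)) ->
  exists g' : family A N, let K' R := K R || (R \subset S) in
    [/\ nat_on K' g', thin_on K' Th g' & agree_on K g' g].
Proof.
move=> dc gn gt cons nKk Kj Thc Thk.
have [aS kS bS akb _] := cons.
have S0 : S != set0 by apply/set0Pn; exists k.
have [n [io [r [eS rio ior ioS]]]] := set_section S0.
have [rk rb] := section_consecutive cons rio ior ioS.
have rbn := ltn_ord (r b).
have Kh m (al : hom m n) : hornQ (r k) (im al) -> K (im (comph io al)).
  case/existsP=> j /andP[jk jal]; apply: dc (Kj (io j) (ioS j) _).
    apply/im_subP => i; rewrite comphE !inE ioS andbT.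
    apply: contraNneq jal => /(congr1 r); rewrite !rio => <-; exact: in_im.
  by apply/eqP => e; move: jk; rewrite -e rio eqxx.
have [||x [xe xt]] := @Hhorn n (r k) ltac:(lia) (fun m al => g m (comph io al)).
- by move=> m l be al h; rewrite -gn ?comphA ?Kh.
- move=> m al h c; apply: gt; first exact: Kh.
  have hit s : s \in S -> (r k).-1 <= r s <= (r k).+1 -> s \in im (comph io al).
    move=> sS /c /imP[i e]; apply/imP; exists i; by rewrite comphE e ior.
  by apply: Thc; apply: hit => //; move: rk rb; clear; lia.
pose y := (fun m (al : hom m N) => sact (comph r al) x) : family A N.
have fact m (al : hom m N) : im al \subset S -> comph io (comph r al) = al.
  by move/im_subP=> h; apply: homP => i; rewrite !comphE ior.
have dS : down_closed (fun R => R \subset S) by move=> R R' /subset_trans; apply.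
(* As [S :\ k] is not in [K], a simplex of [S] lying in [K] misses some vertex other than [k], hence
   lies in the horn, where [x] was prescribed. *)
have missing (R : {set 'I_N.+1}) : R \subset S -> K R ->
    exists j, [/\ j \in S, j != k & j \notin R].
  move=> RS KR; have [/existsP[j /and3P[]]|/existsPn h] :=
    boolP [exists j, [&& j \in S, j != k & j \notin R]]; first by exists j.
  case/negP: nKk; apply: dc KR; apply/subsetP => j; rewrite !inE => /andP[jk jS].
  by have := h j; rewrite jS jk /= negbK.
have [|g' [g'n g'g g'y]] := glue dc dS gn (nat_on_sact x r (K := _)).
- move=> m al /andP[Kal alS]; rewrite xe; first by rewrite fact.
  have [j [jS jk jal]] := missing _ alS Kal.
  apply/existsP; exists (r j); apply/andP; split.
    by apply: contraNneq jk => /val_inj e; rewrite -(ior j jS) e ior.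
  apply: contraNN jal => /imP[i]; rewrite comphE => e; apply/imP; exists i.
  by rewrite -(ior j jS) -e ior // (im_subP _ _ alS).
exists g'; split=> //.
have gcov m (al : hom m N) : im al \subset S ->
    a \in im al -> k \in im al -> b \in im al -> thin (g' m al).
  move=> alS aal kal bal; rewrite g'y //; apply: xt => j jk.
  have [ja|jna] := eqVneq (j : nat) (r a).
    rewrite (_ : j = r a); last exact: val_inj.
    by case/imP: aal => i <-; apply/imP; exists i; rewrite comphE.
  have [jb|jnb] := eqVneq (j : nat) (r b).
    rewrite (_ : j = r b); last exact: val_inj.
    by case/imP: bal => i <-; apply/imP; exists i; rewrite comphE.
  rewrite (_ : j = r k); last by apply: ord_inj; move: rk rb jk jna jnb; clear; lia.
  by case/imP: kal => i <-; apply/imP; exists i; rewrite comphE.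
move=> m al /orP[Kal|alS] Tal; first by rewrite g'g //; apply: gt.
have [Kal|nKal] := boolP (K (im al)); first by rewrite g'g //; apply: gt.
have full j : j \in S -> j != k -> j \in im al.
  move=> jS jk; apply: contraNT nKal => jal; apply: dc (Kj j jS jk).
  apply/subsetP => i ial; rewrite !inE (subsetP alS) // andbT.
  by apply: contraNneq jal => <-.
have ak : a != k by apply/eqP => e; rewrite e ltnn in akb.
have bk : b != k by apply/eqP => e; rewrite e ltnn andbF in akb.
have [kal|nkal] := boolP (k \in im al); first by apply: gcov => //; apply: full.
have ial : im al = S :\ k.
  apply/setP => j; rewrite !inE; apply/idP/andP => [jal|[jk jS]]; last exact: full.
  by split; [apply: contraNneq nkal => <-|apply: (subsetP alS)].
have [|cS Tj] := Thk; first by rewrite -ial.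
apply: (@thin_face N (fun R => K R || (R \subset S)) g' S a k b) ial => //.
- by move=> R R' sR /orP[/(dc _ _ sR)->//|/(subset_trans sR)->]; rewrite orbT.
- by rewrite subxx orbT.
- move=> j jS jk m' be ibe; rewrite g'g ?ibe ?Kj //.
  by apply: gt; rewrite ?ibe ?Kj ?Tj.
Qed.

(* The members of [F] are filled by increasing size, so that the faces [S :\ j] precede [S]. *)
Lemma fill_family N (Th : {set 'I_N.+1} -> bool) (k a : 'I_N.+1)
    (F : {set {set 'I_N.+1}}) (K : {set 'I_N.+1} -> bool) (g : family A N) :
  down_closed K -> nat_on K g -> thin_on K Th g ->
  (forall R : {set 'I_N.+1}, a \in R -> k \in R -> Th R) -> (k = a.+1 :> nat) ->
  (forall S, S \in F -> [/\ a \in S, k \in S & exists2 b : 'I_N.+1, k < b & b \in S]) ->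
  (forall S, S \in F -> ~~ K (S :\ k)) ->
  (forall S, S \in F -> forall j, j \in S -> j != k -> K (S :\ j) || (S :\ j \in F)) ->
  (forall S, S \in F -> Th (S :\ k) ->
     3 < #|S| /\ forall j, j \in S -> j != k -> Th (S :\ j)) ->
  exists g' : family A N, let K' R := K R || (k |: R \in F) in
    [/\ down_closed K', nat_on K' g', thin_on K' Th g' & agree_on K g' g].
Proof.
move=> dc gn gt Thc ka.
move: {2}#|F|.+1 (ltnSn #|F|) => c; elim: c F => // c IH F cF Fin FK Fj FT.
(* The vertices of [R :\: R'] are removed one at a time. Removing [k] leaves [k |: R] unchanged; for
   any other vertex the hypothesis on faces applies. *)
have dcF : down_closed (fun R => K R || (k |: R \in F)).
  move=> R R' sR; move: R' {-2}R' (erefl R') sR => R0 R' _ sR.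
  have [d] := ubnP #|R :\: R'|; elim: d R sR => // d IHd R sR lt KR.
  have [e|/set0Pn[j]] := eqVneq (R :\: R') set0.
    suff -> : R' = R by [].
    by apply/eqP; rewrite eqEsubset sR -setD_eq0 e eqxx.
  rewrite inE => /andP[jR' jR].
  apply: (IHd (R :\ j)).
  - by rewrite subsetD1 sR jR'.
  - rewrite -ltnS; apply: leq_trans lt; rewrite ltnS; apply: proper_card; apply/properP; split.
      by apply: setSD; apply: subD1set.
    by exists j; rewrite !inE ?jR ?jR' ?eqxx.
  case/orP: KR => [/(dc _ (R :\ j) (subD1set _ _))->//|kR].
  have [jk|jk] := eqVneq j k.
    rewrite jk in jR *; rewrite setD1K //; move: kR.
    by rewrite (setUidPr _) ?sub1set // => ->; rewrite orbT.
  have := Fj _ kR j; rewrite !inE jR orbT => /(_ isT jk).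
  have e : (k |: R) :\ j = k |: (R :\ j).
    by apply/setP => i; rewrite !inE; case: (eqVneq i k) => [->|];
      rewrite ?(eq_sym k) ?jk ?andbT ?andbF ?orbF.
  rewrite e => /orP[h|->]; last by rewrite orbT.
  by rewrite (dc _ _ _ h) // subsetUr.
have [F0|/set0Pn[S0 S0F]] := eqVneq F set0.
  exists g; split=> //; first by move=> m n be al; rewrite F0 inE orbF => /gn.
  by move=> m al; rewrite F0 inE orbF => /gt.
(* A largest member is filled last: by its size it is no proper face of another member, so the
   induction hypothesis applies to the rest. *)
pose S := [arg max_(S > S0 in F) #|S|].
have [SF Smax] : S \in F /\ forall R, R \in F -> #|R| <= #|S|.
  by rewrite /S; case: arg_maxnP.
have [|||||g1 [dc1 n1 t1 e1]] := IH (F :\ S).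
- have := cardsD1 S F; rewrite SF; lia.
- by move=> R; rewrite inE => /andP[_]; apply: Fin.
- by move=> R; rewrite inE => /andP[_]; apply: FK.
- move=> R; rewrite inE => /andP[_ RF] j jR jk.
  have /orP[->//|h] := Fj R RF j jR jk; rewrite !inE h andbT.
  apply/orP; right; apply/eqP => e.
  by have := Smax R RF; rewrite -e; have := cardsD1 j R; rewrite jR; lia.
- by move=> R; rewrite inE => /andP[_]; apply: FT.
have [aS kS [b0 kb0 b0S]] := Fin S SF.
have Pb0 : (b0 \in S) && (k < b0) by rewrite b0S.
have [b /andP[bS kb] bmin] := @arg_minnP _ b0 (fun b => (b \in S) && (k < b)) (@nat_of_ord _) Pb0.
have cons : consecutive S a k b.
  split=> //; first by rewrite kb ka ltnSn.
  move=> s sS /andP[as_ sb]; apply: ord_inj.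
  have [//|ne] := eqVneq (s : nat) k.
  by have := bmin s; rewrite sS /=; lia.
have kdel : k |: (S :\ k) = S by rewrite setD1K.
have [||||g2 [n2 t2 e2]] := fill_one dc1 n1 t1 cons.
(* The face [S :\ k] is still missing: adding [k] to it gives [S], just taken out of the family. *)
- by rewrite negb_or FK // kdel !inE eqxx.
- move=> j jS jk; have /orP[->//|h] := Fj S SF j jS jk.
  have -> : k |: S :\ j = S :\ j by apply/setUidPr; rewrite sub1set !inE eq_sym jk.
  rewrite !inE h andbT orbC; apply/orP; left; apply/eqP => e.
  by have := jS; rewrite -e !inE eqxx.
- by move=> R aR kR _; apply: Thc.
- exact: FT.
have sub (R : {set 'I_N.+1}) : K R || (k |: R \in F) ->
    (K R || (k |: R \in F :\ S)) || (R \subset S).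
  case/orP=> [->//|h]; rewrite !inE h andbT.
  by have [<-|] := eqVneq (k |: R) S; rewrite ?subsetUr ?orbT.
exists g2; split=> //.
- by move=> m n be al /sub; apply: n2.
- by move=> m al /sub; apply: t2.
- by move=> m al h; rewrite e2 ?e1 ?h.
Qed.
End InnerHorns.

(** * Outer extensions *)

Lemma four_elements (T : finType) (S : {set T}) (x y z w : T) :
  uniq [:: x; y; z; w] -> x \in S -> y \in S -> z \in S -> w \in S -> 3 < #|S|.
Proof.
move=> u xS yS zS wS; rewrite -[4]/(size [:: x; y; z; w]) -(card_uniqP u).
by apply: subset_leq_card; apply/subsetP => s; rewrite !inE => /or4P[] /eqP ->.
Qed.

Lemma or_down N (K K' : {set 'I_N.+1} -> bool) :
  down_closed K -> down_closed K' -> down_closed (fun R => K R || K' R).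
Proof. by move=> h h' R R' s /orP[/(h _ _ s)->//|/(h' _ _ s)->]; rewrite orbT. Qed.

(** * Complexes on four letters and further vertices *)

Section Letters.
Variable d : nat.
Implicit Types R S : {set 'I_d.+4.+1}.

Definition lett (i : nat) : 'I_d.+4.+1 := inord i.
Definition has_lett i R := lett i \in R.
Definition full R := [forall j : 'I_d.+4.+1, (4 <= j) ==> (j \in R)].
Definition bare R := [forall j : 'I_d.+4.+1, (4 <= j) ==> (j \notin R)].

Lemma lettK i : i < 5 -> lett i = i :> nat.
Proof. by move=> i5; rewrite inordK //; lia. Qed.

Lemma lett_eq l (j : 'I_d.+4.+1) : l < 5 -> (j == lett l) = ((j : nat) == l).
Proof. by move=> l5; rewrite -{2}(lettK l5). Qed.

Lemma lett_inj i j : i < 5 -> j < 5 -> (lett i == lett j) = (i == j).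
Proof. by move=> i5 j5; rewrite -val_eqE /= !lettK. Qed.

Lemma lettP (j : 'I_d.+4.+1) : {l | l < 4 & j = lett l} + {4 <= j}.
Proof.
have [j4|j4] := leqP 4 j; [by right | left].
by exists j => //; apply: ord_inj; rewrite lettK //; lia.
Qed.

Lemma lett_neq l (j : 'I_d.+4.+1) : l < 4 -> 4 <= j -> (j == lett l) = false.
Proof.
move=> l4 j4; apply/negbTE/eqP => /(congr1 (@nat_of_ord _)).
rewrite lettK; lia.
Qed.

Lemma has_lett_del i l R : i < 4 -> l < 4 ->
  has_lett i (R :\ lett l) = (i != l) && has_lett i R.
Proof. by move=> i4 l4; rewrite /has_lett !inE lett_inj //; lia. Qed.

Lemma has_lett_add i l R : i < 4 -> l < 4 ->
  has_lett i (lett l |: R) = (i == l) || has_lett i R.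
Proof. by move=> i4 l4; rewrite /has_lett !inE lett_inj //; lia. Qed.

Lemma full_del l R : l < 4 -> full (R :\ lett l) = full R.
Proof.
move=> l4; apply: eq_forallb => j; case: (leqP 4 j) => //= j4; rewrite !inE.
by rewrite lett_neq.
Qed.

Lemma full_add l R : l < 4 -> full (lett l |: R) = full R.
Proof.
move=> l4; apply: eq_forallb => j; case: (leqP 4 j) => //= j4; rewrite !inE.
by rewrite lett_neq.
Qed.

Lemma bare_del l R : l < 4 -> bare (R :\ lett l) = bare R.
Proof.
move=> l4; apply: eq_forallb => j; case: (leqP 4 j) => //= j4; rewrite !inE.
by rewrite lett_neq.
Qed.

Lemma bare_add l R : l < 4 -> bare (lett l |: R) = bare R.
Proof.
move=> l4; apply: eq_forallb => j; case: (leqP 4 j) => //= j4; rewrite !inE.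
by rewrite lett_neq.
Qed.

Lemma has_lett_delB i (j : 'I_d.+4.+1) R : i < 4 -> 4 <= j -> has_lett i (R :\ j) = has_lett i R.
Proof.
by move=> i4 j4; rewrite /has_lett !inE eq_sym lett_neq.
Qed.

Lemma full_delB (j : 'I_d.+4.+1) R : 4 <= j -> full (R :\ j) = false.
Proof.
by move=> j4; apply/negbTE/forallPn; exists j; rewrite j4 !inE eqxx.
Qed.

Lemma bare_mem (j : 'I_d.+4.+1) R : 4 <= j -> j \in R -> bare R = false.
Proof.
by move=> j4 jR; apply/negbTE/forallPn; exists j; rewrite j4 jR.
Qed.

Lemma full_bare R : ~~ (full R && bare R).
Proof.
apply/negP => /andP[/forallP/(_ ord_max) /= h1 /forallP/(_ ord_max) /= h2].
by move: h2; rewrite h1.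
Qed.

Lemma bareP R : ~~ bare R -> exists2 j : 'I_d.+4.+1, 4 <= j & j \in R.
Proof. by move=> /forallPn[j]; rewrite negb_imply negbK => /andP[]; exists j. Qed.

Lemma has_lett_sub i R S : R \subset S -> has_lett i R ==> has_lett i S.
Proof. by move/subsetP => s; apply/implyP; apply: s. Qed.

Lemma full_sub R S : R \subset S -> full R ==> full S.
Proof.
move/subsetP => s; apply/implyP => /forallP h; apply/forallP => j.
by apply/implyP => /(implyP (h j)); apply: s.
Qed.

Lemma bare_sub R S : R \subset S -> bare S ==> bare R.
Proof.
move/subsetP => s; apply/implyP => /forallP h; apply/forallP => j.
by apply/implyP => /(implyP (h j)); apply: contraNN; apply: s.
Qed.

Lemma lett_card i j l R : i < j -> j < l -> l < 4 ->
  has_lett i R -> has_lett j R -> has_lett l R -> ~~ bare R -> 3 < #|R|.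
Proof.
move=> ij jl l4 ci cj cl /bareP[b b4 bR]; apply: (four_elements _ ci cj cl bR).
rewrite /= !inE !lett_inj ?[_ == b]eq_sym ?lett_neq //; lia.
Qed.

Definition two_letts R :=
  [|| has_lett 0 R && [|| has_lett 1 R, has_lett 2 R | has_lett 3 R],
      has_lett 1 R && (has_lett 2 R || has_lett 3 R) |
      has_lett 2 R && has_lett 3 R].

Lemma two_lettsI R i j : i < j < 4 -> has_lett i R -> has_lett j R -> two_letts R.
Proof.
move: i j => [|[|[|i]]] [|[|[|[|j]]]] // ij; try lia;
by rewrite /two_letts => -> ->; rewrite ?orbT.
Qed.

(* Complexes are described by the letters of a set [R] and by whether [R] contains all
   ([full]) or none ([bare]) of the other vertices.  The initial map is given on [K_a] and
   [K_b] by the family on [Delta d.+2], which is defined everywhere if [t] and otherwise on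
   the horn only, and on [K_c] by the map out of [E_2].  Each [F_i] lists the simplices
   filled by inner horns at the letters [3], [2], [1] respectively; on [K_d] the letters
   [1] and [3] are identified. *)
Definition K_a t R := ~~ has_lett 1 R && [|| ~~ has_lett 3 R, ~~ full R | t].
Definition K_b t R := [&& ~~ has_lett 0 R, ~~ has_lett 2 R & ~~ full R || t].
Definition K_c R := bare R && (~~ has_lett 0 R || ~~ has_lett 3 R).
Definition K_0 t R := (K_a t R || K_b t R) || K_c R.
Definition F_1 t : {set {set 'I_d.+4.+1}} :=
  [set S | [&& ~~ has_lett 0 S, has_lett 1 S, has_lett 2 S, has_lett 3 S, ~~ bare S
             & ~~ full S || t]].
Definition K_1 t R := K_0 t R || (lett 3 |: R \in F_1 t).
Definition F_2 : {set {set 'I_d.+4.+1}} :=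
  [set S | [&& has_lett 1 S, has_lett 2 S &
     [|| [&& has_lett 0 S, ~~ has_lett 3 S & ~~ bare S],
         [&& has_lett 0 S, has_lett 3 S & ~~ full S] |
         [&& ~~ has_lett 0 S, ~~ has_lett 3 S & full S]]]].
Definition K_2 R := K_1 false R || (lett 2 |: R \in F_2).
Definition K_d R := ~~ has_lett 0 R && ~~ has_lett 2 R.
Definition K_3 R := K_2 R || K_d R.
Definition F_3 : {set {set 'I_d.+4.+1}} :=
  [set S | [&& has_lett 0 S, has_lett 1 S, ~~ has_lett 2 S, has_lett 3 S & full S]].
Definition K_4 R := K_3 R || (lett 1 |: R \in F_3).

(** Membership in a complex depends on six booleans: the four letters, [full] and [bare]. After
    rewriting, the claims are propositional, and [full_bare] excludes the impossible combination. *)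
Ltac letters S :=
  rewrite /K_4 /K_3 /K_2 /K_1 /K_0 /K_a /K_b /K_c /K_d /two_letts ?inE
    ?has_lett_add ?full_add ?bare_add ?has_lett_del ?full_del ?bare_del //=;
  move: (full_bare S);
  case: (has_lett 0 S); case: (has_lett 1 S) => //=; case: (has_lett 2 S) => //=;
  case: (has_lett 3 S) => //=; case: (full S) => //=; case: (bare S) => //=.

Ltac sub_letters RR SS s :=
  rewrite /K_4 /K_3 /K_2 /K_1 /K_0 /K_a /K_b /K_c /K_d /two_letts ?inE
    ?has_lett_add ?full_add ?bare_add //=;
  move: (has_lett_sub 0 s) (has_lett_sub 1 s) (has_lett_sub 2 s) (has_lett_sub 3 s)
    (full_sub s) (bare_sub s) (full_bare RR) (full_bare SS);
  case: (has_lett 0 SS) => //=; case: (has_lett 0 RR) => //=;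
  case: (has_lett 1 SS) => //=; case: (has_lett 1 RR) => //=;
  case: (has_lett 2 SS) => //=; case: (has_lett 2 RR) => //=;
  case: (has_lett 3 SS) => //=; case: (has_lett 3 RR) => //=;
  case: (full SS) => //=; case: (full RR) => //=; case: (bare SS) => //=; case: (bare RR) => //=.

Lemma K_a_down t : down_closed (K_a t).
Proof. by move=> R R' s; sub_letters R' R s. Qed.
Lemma K_b_down t : down_closed (K_b t).
Proof. by move=> R R' s; sub_letters R' R s. Qed.
Lemma K_c_down : down_closed K_c.
Proof. by move=> R R' s; sub_letters R' R s. Qed.
Lemma K_d_down : down_closed K_d.
Proof. by move=> R R' s; sub_letters R' R s. Qed.

(** The [_horn], [_face], [_thin] and [_bound] lemmas for [F_1], [F_2], [F_3] are the hypotheses of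
    [fill_family] at the three stages. *)
Lemma F_1_horn t S : S \in F_1 t -> ~~ K_0 t (S :\ lett 3).
Proof. by letters S; case: t. Qed.

Lemma F_2_horn S : S \in F_2 -> ~~ K_1 false (S :\ lett 2).
Proof. by letters S. Qed.

Lemma F_3_horn S : S \in F_3 -> ~~ K_3 (S :\ lett 1).
Proof. by letters S. Qed.

Lemma K_2_intro S :
  ~~ has_lett 0 S -> ~~ has_lett 2 S -> ~~ has_lett 3 S -> K_2 S.
Proof. by letters S. Qed.

Lemma K_2_full S : K_2 S -> K_d S -> full S -> ~~ has_lett 3 S.
Proof. by letters S. Qed.

Lemma K_4_intro S : ~~ has_lett 1 S -> ~~ has_lett 2 S -> K_4 S.
Proof. by letters S. Qed.

Lemma F_1_face t S : S \in F_1 t -> forall j, j \in S -> j != lett 3 ->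
  K_0 t (S :\ j) || (S :\ j \in F_1 t).
Proof.
move=> SF j jS; case: (lettP j) => [[l l4 ->]|j4].
  rewrite lett_inj; [|lia..]; move: SF l4.
  by case: l => [|[|[|[|l]]]] // + _ _; letters S; case: t.
move=> _; move: SF; rewrite /K_0 /K_a /K_b /K_c !inE.
rewrite !has_lett_delB // full_delB // (bare_mem j4 jS).
by case: (bare _); letters S; case: t.
Qed.

Lemma F_2_face S : S \in F_2 -> forall j, j \in S -> j != lett 2 ->
  K_1 false (S :\ j) || (S :\ j \in F_2).
Proof.
move=> SF j jS; case: (lettP j) => [[l l4 ->]|j4].
  rewrite lett_inj; [|lia..]; move: SF l4.
  by case: l => [|[|[|[|l]]]] // + _ _; letters S.
move=> _; move: SF; rewrite /K_1 /K_0 /K_a /K_b /K_c !inE ?has_lett_add ?full_add ?bare_add //.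
rewrite !has_lett_delB // full_delB // (bare_mem j4 jS).
by case: (bare _); letters S.
Qed.

Lemma F_3_face S : S \in F_3 -> forall j, j \in S -> j != lett 1 ->
  K_3 (S :\ j) || (S :\ j \in F_3).
Proof.
move=> SF j jS; case: (lettP j) => [[l l4 ->]|j4].
  rewrite lett_inj; [|lia..]; move: SF l4.
  by case: l => [|[|[|[|l]]]] // + _ _; letters S.
move=> _; move: SF; rewrite /K_3 /K_2 /K_1 /K_0 /K_a /K_b /K_c /K_d !inE.
rewrite ?has_lett_add ?full_add ?bare_add //.
rewrite !has_lett_delB // full_delB // ?(bare_mem j4 jS).
by case: (bare _); letters S.
Qed.

Lemma two_letts_del S (j : 'I_d.+4.+1) i1 i2 i3 : i1 < i2 -> i2 < i3 -> i3 < 4 ->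
  has_lett i1 S -> has_lett i2 S -> has_lett i3 S -> two_letts (S :\ j).
Proof.
move=> h1 h2 h3 c1 c2 c3; case: (lettP j) => [[l l4 ->]|j4]; last first.
  by apply: (@two_lettsI _ i1 i2); rewrite ?has_lett_delB //; lia.
have [e1|e1] := eqVneq i1 l.
  by apply: (@two_lettsI _ i2 i3); rewrite ?has_lett_del ?c2 ?c3 ?andbT //; lia.
have [e2|e2] := eqVneq i2 l.
  by apply: (@two_lettsI _ i1 i3); rewrite ?has_lett_del ?c1 ?c3 ?andbT //; lia.
by apply: (@two_lettsI _ i1 i2); rewrite ?has_lett_del ?c1 ?c2 ?andbT //; lia.
Qed.

Lemma F_1_thin t S : S \in F_1 t -> two_letts (S :\ lett 3) ->
  3 < #|S| /\ forall j, j \in S -> j != lett 3 -> two_letts (S :\ j).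
Proof.
rewrite inE => /and5P[_ c1 c2 c3 /andP[b _]] _; split; first exact: (lett_card _ _ _ c1 c2 c3).
by move=> j _ _; apply: (two_letts_del _ _ _ _ c1 c2 c3).
Qed.

Lemma F_2_thin S : S \in F_2 -> two_letts (S :\ lett 2) ->
  3 < #|S| /\ forall j, j \in S -> j != lett 2 -> two_letts (S :\ j).
Proof.
move=> SF T.
(* The members with letters 1 and 2 only are excluded by [T]: without letter 2 they keep a single
   letter, and that face need not be thin. *)
have [c0 c1 c2] : [/\ has_lett 0 S, has_lett 1 S & has_lett 2 S].
  by move: SF T; letters S.
split; last by move=> j _ _; apply: (two_letts_del _ _ _ _ c0 c1 c2).
(* A bare [S] consists of the four letters, which still gives dimension 3. *)
have [b|b] := boolP (bare S); last exact: (lett_card _ _ _ c0 c1 c2).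
have c3 : has_lett 3 S by move: SF b; letters S.
by apply: (four_elements _ c0 c1 c2 c3); rewrite /= !inE !lett_inj.
Qed.

Lemma F_3_thin S : S \in F_3 -> two_letts (S :\ lett 1) ->
  3 < #|S| /\ forall j, j \in S -> j != lett 1 -> two_letts (S :\ j).
Proof.
rewrite inE => /and5P[c0 c1 _ c3 f] _; split.
  by apply: (lett_card _ _ _ c0 c1 c3) => //; have := full_bare S; rewrite f.
by move=> j _ _; apply: (two_letts_del _ _ _ _ c0 c1 c3).
Qed.

Lemma F_1_bound t S : S \in F_1 t ->
  [/\ lett 2 \in S, lett 3 \in S & exists2 b : 'I_d.+4.+1, lett 3 < b & b \in S].
Proof.
rewrite inE => /and5P[_ c1 c2 c3 /andP[/bareP[b b4 bS] _]]; split=> //.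
by exists b; rewrite ?lettK.
Qed.

Lemma F_2_bound S : S \in F_2 ->
  [/\ lett 1 \in S, lett 2 \in S & exists2 b : 'I_d.+4.+1, lett 2 < b & b \in S].
Proof.
move=> SF; have [c1 c2] : has_lett 1 S /\ has_lett 2 S by move: SF; letters S.
split=> //; have [c3|c3] := boolP (has_lett 3 S); first by exists (lett 3); rewrite ?lettK.
have /bareP[b b4 bS] : ~~ bare S by move: SF c3; letters S.
by exists b; rewrite ?lettK //; lia.
Qed.

Lemma F_3_bound S : S \in F_3 ->
  [/\ lett 0 \in S, lett 1 \in S & exists2 b : 'I_d.+4.+1, lett 1 < b & b \in S].
Proof.
rewrite inE => /and5P[c0 c1 _ c3 _]; split=> //.
by exists (lett 3); rewrite ?lettK.
Qed.

Lemma no_lett m (al : hom m d.+4) l i : l < 4 -> ~~ has_lett l (im al) -> al i != l :> nat.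
Proof.
move=> l4; apply: contraNneq => e; apply/imP; exists i.
by apply: ord_inj; rewrite e lettK //; lia.
Qed.

Lemma im_bare m (al : hom m d.+4) i : bare (im al) -> al i < 4.
Proof.
by move/forallP/(_ (al i)); rewrite in_im /= implybF -ltnNge.
Qed.
End Letters.

(** * Maps out of $E_2$ *)

Definition E2_edge (A : strat) (v : A 1) : Prop :=
  exists f : forall m (w : E m), inE2 w -> A m,
    [/\ pnatural f,
        (forall m (w : E m) (p : inE2 w), thin_th1E2 w -> thin (f m w p)) &
        exists p : inE2 e1m, f 1 e1m p = v].

Definition thin1_spec (A : strat) : Prop := forall v : A 1, thin v <-> E2_edge v.

Lemma inE2_sact m n (al : hom m n) (w : E n) : inE2 w -> inE2 (sact al w).
Proof.
by move=> [be [->|->]]; exists (comph be al); [left|right]; rewrite sact_comp.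
Qed.

Lemma EactE m n (al : hom m n) (w : E n) i : (sact al w : {ffun _}) i = (w : {ffun _}) (al i).
Proof. by rewrite /= ffunE. Qed.

Lemma w_mpmE i : w_mpm i = ((i : nat) == 1).
Proof. by rewrite ffunE. Qed.
Lemma w_pmpE i : w_pmp i = ((i : nat) != 1).
Proof. by rewrite ffunE. Qed.
Lemma e1mE i : e1m i = ((i : nat) == 1).
Proof. by rewrite ffunE. Qed.

Lemma inE2_e1m : inE2 e1m.
Proof.
exists (mkh 1 2 id_homo); left; apply/ffunP => i; rewrite EactE e1mE w_mpmE mkhE.
by have := ltn_ord i; lia.
Qed.

Definition Eneg m (w : E m) : E m := [ffun i => ~~ (w : {ffun _}) i].

Lemma Eneg_sact m n (al : hom m n) (w : E n) : Eneg (sact al w) = sact al (Eneg w).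
Proof. by apply/ffunP => i; rewrite !ffunE. Qed.

Lemma inE2_neg m (w : E m) : inE2 w -> inE2 (Eneg w).
Proof.
move=> [al [->|->]]; exists al; rewrite Eneg_sact; [right|left]; congr sact;
  by apply/ffunP => i; rewrite !ffunE ?negbK.
Qed.

(** A total function with arbitrary values outside $E_2$. Thinness is asked in all positive
    dimensions, which for edges goes beyond stratification and comes from [thin1_spec]. *)
Definition E2_map (A : strat) (f : forall m, E m -> A m) : Prop :=
  (forall m n (al : hom m n) (w : E n), inE2 w -> f m (sact al w) = sact al (f n w)) /\
  (forall m (w : E m), inE2 w -> 0 < m -> thin (f m w)).

Lemma thin1_E2_map (A : strat) (v : A 1) : thin1_spec A -> thin v ->
  exists f, E2_map f /\ f 1 e1m = v.
Proof.
move=> spec /spec [f [fn ft [p fv]]].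
have [F FE] := totalize f (fun m => inhabits (sact (mkh m 1 (const_homo 0)) v)).
have Fn m n (al : hom m n) (w : E n) : inE2 w -> F m (sact al w) = sact al (F n w).
  by move=> q; rewrite (FE _ _ q) (FE _ _ (inE2_sact al q)) (fn _ _ _ _ q).
have Fv : F 1 e1m = v by rewrite (FE _ _ p).
have Fd m (w : E m) : degenE2 w -> thin (F m w).
  move=> [l [al [y [lm yE ->]]]]; apply: thin_degen.
  by exists l, al, (F l y); split=> //; rewrite Fn.
have F2 m (w : E m) : inE2 w -> 1 < m -> thin (F m w).
  by move=> q m1; rewrite (FE _ _ q); apply: ft; left.
exists F; split=> //; split=> // -[//|[|m]] w q _; last exact: F2.
pose i0 : 'I_2 := ord0; pose i1 : 'I_2 := ord_max.
have case2 (i : 'I_2) : i = i0 \/ i = i1.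
  by case: i => -[|[|//]] lt; [left|right]; apply: ord_inj.
have [e|ne] := eqVneq ((w : {ffun _}) i0) ((w : {ffun _}) i1).
  apply: Fd; exists 0, (mkh 1 0 (const_homo 0)), (sact (mkh 0 1 (const_homo 0)) w).
  split=> //; first exact: inE2_sact.
  apply/ffunP => i; rewrite !EactE.
  rewrite (_ : mkh 0 1 _ _ = i0); last by apply: ord_inj; rewrite mkhE.
  by case: (case2 i) => ->.
have [w1|w1] := boolP ((w : {ffun _}) i1).
  suff -> : w = e1m by rewrite Fv; apply/spec; exists f; split=> //; exists p.
  apply/ffunP => i; rewrite [RHS]ffunE; move: ne w1.
  by case: (case2 i) => ->; case: (_ i0) => //; case: (_ i1).
(* The word [+-] is thin because exchanging the letters is an automorphism of [E_2]. *)
apply/spec; exists (fun m w _ => F m (Eneg w)); split.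
- by move=> m n al x q' r; rewrite Eneg_sact Fn //; apply: inE2_neg.
- move=> m x q' [m1|[l [al [y [lm yE ->]]]]]; first by apply: F2 => //; apply: inE2_neg.
  rewrite Eneg_sact; apply: Fd; exists l, al, (Eneg y); split=> //.
  exact: inE2_neg.
- exists p; congr (F 1 _); apply/ffunP => i; rewrite !ffunE; move: ne w1.
  by case: (case2 i) => ->; case: (_ i0) => //; case: (_ i1).
Qed.

Lemma pa_homo : {homo (fun i => i - 2) : i j / i <= j}.
Proof. by move=> i j; lia. Qed.
Lemma pb_homo : {homo (fun i => maxn (i - 2) (minn i 1)) : i j / i <= j}.
Proof. by move=> i j; lia. Qed.

(** On [K_a], which lacks letter 1, [p_a] sends letters 0 and 2 to vertex 0 and letter 3 to vertex
    1; on [K_b], which has only letters 1 and 3, [p_b] sends both to vertex 1. A further vertex [j]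
    goes to [j - 2]. *)
Definition p_a d := mkh d.+4 d.+2 pa_homo.
Definition p_b d := mkh d.+4 d.+2 pb_homo.

Lemma p_aE d i : p_a d i = i - 2 :> nat.
Proof. by rewrite mkhE; have := ltn_ord i; lia. Qed.
Lemma p_bE d i : p_b d i = maxn (i - 2) (minn i 1) :> nat.
Proof. by rewrite mkhE; have := ltn_ord i; lia. Qed.

Lemma horn_missing n m (al : hom m n) (j : nat) : 0 < j <= n ->
  (forall i, (al i : nat) <> j) -> hornQ 0 (im al).
Proof.
case/andP=> j0 jn h; have jn' : j < n.+1 by [].
apply/existsP; exists (Ordinal jn'); rewrite -lt0n j0 /=.
by apply/imP => -[i e]; apply: (h i); rewrite e.
Qed.

Lemma not_full d m (al : hom m d.+4) : ~~ full (im al) ->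
  exists2 j, 4 <= j <= d.+4 & forall i, (al i : nat) <> j.
Proof.
move=> /forallPn[j]; rewrite negb_imply => /andP[j4 jal].
exists (j : nat); first by have := ltn_ord j; lia.
by move=> i /ord_inj e; move: jal; rewrite -e in_im.
Qed.

Lemma K_a_horn t d m (al : hom m d.+4) : K_a t (im al) -> t || hornQ 0 (im (comph (p_a d) al)).
Proof.
case: t => //= /andP[c1 /or3P[c3|/not_full[j jn h]|//]].
  apply: (@horn_missing _ _ _ 1) => // i; rewrite comphE p_aE.
  by have := no_lett i (isT : 3 < 4) c3; lia.
by apply: (@horn_missing _ _ _ (j - 2)) => [|i]; rewrite ?comphE ?p_aE; [|have := h i]; lia.
Qed.

Lemma K_b_horn t d m (al : hom m d.+4) : K_b t (im al) -> t || hornQ 0 (im (comph (p_b d) al)).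
Proof.
case: t => //= /and3P[c0 c2 /orP[/not_full[j jn h]|//]].
by apply: (@horn_missing _ _ _ (j - 2)) => [|i]; rewrite ?comphE ?p_bE; [|have := h i]; lia.
Qed.

Lemma has_lettP d m (al : hom m d.+4) l : l < 4 -> has_lett l (im al) ->
  exists i, al i = l :> nat.
Proof. by move=> l4 /imP[i e]; exists i; rewrite e lettK //; lia. Qed.

(** * Outer extensions at [k = 0] *)

Section Stages.
Variable A : strat.
Hypothesis Hhorn : forall n k, 0 < k < n -> horn_fill A n k.
Hypothesis Hthin : forall n k, 2 < n -> 0 < k < n -> thin_fill A n k.
Hypothesis spec : thin1_spec A.

(** The maps through [p_a] and [p_b] agree on their overlap, where at most letter 3 occurs. Both
    agree with the map out of $E_2$ because bare simplices land in the edge 01, the image of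
    [e1m]. *)
Lemma stage0 d t (h : family A d.+2) (Q := fun R => t || @hornQ d.+2 0 R) :
  nat_on Q h ->
  (forall m (al : hom m d.+2), Q (im al) -> covers 0 (im al) -> thin (h m al)) ->
  exists g : family A d.+4,
    [/\ nat_on (K_0 t) g, thin_on (K_0 t) (@two_letts d) g,
        agree_on (K_a t) g (fun m al => h m (comph (p_a d) al)) &
        agree_on (K_b t) g (fun m al => h m (comph (p_b d) al))].
Proof.
move=> hn ht.
have Qd : down_closed Q by move=> R R' s /orP[|/(hornQ_down s)] e; apply/orP; [left|right].
have na : nat_on (K_a t) (fun m (al : hom m d.+4) => h m (comph (p_a d) al)).
  by move=> m n be al /K_a_horn q; rewrite -hn // comphA.
have nb : nat_on (K_b t) (fun m (al : hom m d.+4) => h m (comph (p_b d) al)).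
  by move=> m n be al /K_b_horn q; rewrite -hn // comphA.
have [|g1 [n1 e1a e1b]] := glue (@K_a_down d t) (@K_b_down d t) na nb.
  move=> m al /andP[/andP[c1 _] /and3P[c0 c2 _]]; congr (h m _).
  apply: homP => i; rewrite !comphE p_aE p_bE.
  have := no_lett i (isT : 0 < 4) c0; have := no_lett i (isT : 1 < 4) c1.
  by have := no_lett i (isT : 2 < 4) c2; lia.
pose ed := mkh 1 d.+2 id_homo.
have edE i : ed i = i :> nat by rewrite mkhE; have := ltn_ord i; lia.
(* The edge 01 misses vertex 2, so it lies in the horn; it covers 0 and 1, so it is thin. *)
have Qed_ : Q (im ed).
  apply/orP; right; apply: (@horn_missing _ _ _ 2) => // i; rewrite edE.
  by have := ltn_ord i; lia.
have ved : thin (h 1 ed).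
  apply: ht => // j j1; apply/imP; exists (inord j); apply: ord_inj.
  by rewrite edE inordK; lia.
have [f [[fn ft] fv]] := thin1_E2_map spec ved.
pose W : E d.+4 := [ffun i : 'I_d.+4.+1 => odd i].
have WE m (al : hom m d.+4) i : (sact al W : {ffun _}) i = odd (al i) by rewrite EactE ffunE.
(* The word [W] spells [-+-+] on the letters. Without letter 0 it is a piece of [+-+], read with a
   shift by 1; without letter 3 it is a piece of [-+-]. *)
have Win m (al : hom m d.+4) : K_c (im al) -> inE2 (sact al W).
  move=> /andP[em /orP[c0|c3]].
    have sub1_homo : {homo (fun i => i - 1) : i j / i <= j} by move=> i j; lia.
    exists (comph (mkh d.+4 2 sub1_homo) al); right; apply/ffunP => i.
    rewrite WE EactE w_pmpE comphE mkhE.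
    have := no_lett i (isT : 0 < 4) c0; have := im_bare i em.
    by case: (al i : nat) => [|[|[|[|]]]] //; lia.
  exists (comph (mkh d.+4 2 id_homo) al); left; apply/ffunP => i.
  rewrite WE EactE w_mpmE comphE mkhE.
  have := no_lett i (isT : 3 < 4) c3; have := im_bare i em.
  by case: (al i : nat) => [|[|[|[|]]]] //; lia.
pose gc := (fun m al => f m (sact al W)) : family A d.+4.
have nc : nat_on (@K_c d) gc.
  by move=> m n be al q; rewrite /gc sact_comp fn //; apply: Win.
(* A collapse that agrees with parity factors through the edge 01, so [h] and the map out of $E_2$
   both apply the same operator to that edge. *)
have common m (al : hom m d.+4) (p : nat -> nat) (pM : {homo p : i j / i <= j}) :
    (forall i, p (al i) = odd (al i)) -> h m (comph (mkh d.+4 d.+2 pM) al) = gc m al.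
  move=> pE; pose be := comph (mkh d.+4 1 pM) al.
  have -> : comph (mkh d.+4 d.+2 pM) al = comph ed be.
    by apply: homP => i; rewrite !comphE edE !mkhE pE; case: (odd _).
  rewrite hn // -fv -fn; last exact: inE2_e1m.
  congr (f m _); apply/ffunP => i; rewrite WE EactE e1mE comphE mkhE pE.
  by case: (odd _).
have [|g [gn ge1 gec]] := glue (or_down (@K_a_down d t) (@K_b_down d t)) (@K_c_down d) n1 nc.
  move=> m al /andP[/orP[Ka|Kb] Kc].
    rewrite e1a //; apply: common => i; case/andP: Ka => c1 _; case/andP: Kc => em _.
    have := no_lett i (isT : 1 < 4) c1; have := im_bare i em.
    by case: (al i : nat) => [|[|[|[|]]]].
  rewrite e1b //; apply: common => i; case/and3P: Kb => c0 c2 _; case/andP: Kc => em _.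
  have := no_lett i (isT : 0 < 4) c0; have := no_lett i (isT : 2 < 4) c2; have := im_bare i em.
  by case: (al i : nat) => [|[|[|[|]]]].
have ea : agree_on (K_a t) g (fun m al => h m (comph (p_a d) al)).
  by move=> m al K; rewrite ge1 ?K // e1a.
have eb : agree_on (K_b t) g (fun m al => h m (comph (p_b d) al)).
  by move=> m al K; rewrite ge1 ?K ?orbT // e1b.
(* Two letters make a simplex thin: on [K_a] they are 0 and 2, which collapse, or include 3 and then
   hit both vertices 0 and 1; on [K_b] they are 1 and 3, which collapse; on [K_c] the dimension is
   positive. *)
exists g; split=> // m al /orP[/orP[Ka|Kb]|Kc] tl.
- have c1 : ~~ has_lett 1 (im al) by case/andP: Ka.
  have q := K_a_horn Ka; rewrite ea //.
  have [c3|c3] := boolP (has_lett 3 (im al)); last first.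
    apply: (thin_noninj Qd hn) => // alI.
    have [c0 c2] : has_lett 0 (im al) /\ has_lett 2 (im al).
      by move: tl; rewrite /two_letts (negbTE c1) (negbTE c3) /= orbF !andbF orbF => /andP.
    have [i0 e0] := has_lettP (isT : 0 < 4) c0; have [i2 e2] := has_lettP (isT : 2 < 4) c2.
    have e : i0 = i2 by apply: alI; apply: ord_inj; rewrite !comphE !p_aE e0 e2.
    by move: e0; rewrite e e2.
  apply: ht => // j j1; apply/imP.
  have [i3 e3] := has_lettP (isT : 3 < 4) c3.
  have [i0 e0] : exists i, al i - 2 = 0.
    have [c0|c0] := boolP (has_lett 0 (im al)).
      by have [i e] := has_lettP (isT : 0 < 4) c0; exists i; rewrite e.
    have c2 : has_lett 2 (im al).
      by move: tl; rewrite /two_letts (negbTE c1) (negbTE c0) /= => /andP[].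
    by have [i e] := has_lettP (isT : 2 < 4) c2; exists i; rewrite e.
  have [j0|j0] := posnP j; [exists i0|exists i3]; apply: ord_inj; rewrite comphE p_aE ?e0 ?e3; lia.
- have q := K_b_horn Kb; rewrite eb //.
  apply: (thin_noninj Qd hn) => // alI.
  have [c1 c3] : has_lett 1 (im al) /\ has_lett 3 (im al).
    case/and3P: Kb tl => c0 c2 _.
    by rewrite /two_letts (negbTE c0) (negbTE c2) /= orbF => /andP.
  have [i1 e1] := has_lettP (isT : 1 < 4) c1; have [i3 e3] := has_lettP (isT : 3 < 4) c3.
  have e : i1 = i3 by apply: alI; apply: ord_inj; rewrite !comphE !p_bE e1 e3.
  by move: e1; rewrite e e3.
- rewrite gec //; apply: ft; first exact: Win.
  case: m al Kc tl => // al _ tl.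
  have im0 i : has_lett i (im al) -> i < 4 -> al ord0 = i :> nat.
    by move=> c i4; have [i' <-] := has_lettP i4 c; rewrite [i']ord1.
  move: tl; rewrite /two_letts.
  by move=> /or3P[/andP[/im0 h1 /or3P[]]|/andP[/im0 h1 /orP[]]|/andP[/im0 h1]] /im0 h2;
    move: (h1 isT); rewrite h2.
Qed.

(** Filling at letter 3 creates the faces with letters 1 and 2, along which simplices are carried
    from letter 2 to letter 1. With [t] true this includes the full set of other vertices. *)
Lemma stage1 d t (h : family A d.+2) (Q := fun R => t || @hornQ d.+2 0 R) :
  nat_on Q h ->
  (forall m (al : hom m d.+2), Q (im al) -> covers 0 (im al) -> thin (h m al)) ->
  exists g : family A d.+4,
    [/\ down_closed (@K_1 d t), nat_on (K_1 t) g, thin_on (K_1 t) (@two_letts d) g,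
        agree_on (K_a t) g (fun m al => h m (comph (p_a d) al)) &
        agree_on (K_b t) g (fun m al => h m (comph (p_b d) al))].
Proof.
move=> hn ht; have [g0 [n0 t0 ea eb]] := stage0 hn ht.
have [|||||||g [dc gn gt ge]] :=
  fill_family Hhorn Hthin (k := lett d 3) (a := lett d 2) (F := F_1 d t) _ n0 t0.
- exact: or_down (or_down (@K_a_down d t) (@K_b_down d t)) (@K_c_down d).
- by move=> R c2 c3; apply: (@two_lettsI _ _ 2 3).
- by rewrite !lettK.
- exact: F_1_bound.
- exact: F_1_horn.
- exact: F_1_face.
- exact: F_1_thin.
exists g; split=> // m al K.
- by rewrite ge ?ea // /K_0 K.
- by rewrite ge ?eb // /K_0 K orbT.
Qed.

Lemma p13_homo : {homo (fun i => if i < 4 then minn i 1 else i) : i j / i <= j}.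
Proof. by move=> i j ij; case: ifP; case: ifP; lia. Qed.

Lemma emb_homo : {homo (fun i => if i == 0 then 0 else i + 2) : i j / i <= j}.
Proof. by move=> i j ij; case: ifP; case: ifP; lia. Qed.

Lemma outer_horn_fill d : horn_fill A d.+2 0.
Proof.
move=> h hn ht.
have [g1 [dc1 n1 t1 ea1 eb1]] := @stage1 d false h hn ht.
(* Filling at letter 2 carries the full face from letter 2 to letter 1, and creates [[01]] over all
   other vertices and [[013]] over proper subsets of them. *)
have [||||||g2 [dc2 n2 t2 e2]] :=
  fill_family Hhorn Hthin (Th := @two_letts d) (k := lett d 2) (a := lett d 1) (F := F_2 d)
    dc1 n1 t1.
- by move=> R c1 c2; apply: (@two_lettsI _ _ 1 2).
- by rewrite !lettK.
- exact: F_2_bound.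
- exact: F_2_horn.
- exact: F_2_face.
- exact: F_2_thin.
have {}dc2 : down_closed (@K_2 d) := dc2; have {}n2 : nat_on (@K_2 d) g2 := n2.
have {}t2 : thin_on (@K_2 d) (@two_letts d) g2 := t2.
have K_02 R : K_0 false R -> @K_2 d R by rewrite /K_2 /K_1 => ->.
have ea2 : agree_on (K_a false) g2 (fun m al => h m (comph (p_a d) al)).
  by move=> m al K; rewrite e2 ?ea1 // /K_1 /K_0 K.
have eb2 : agree_on (K_b false) g2 (fun m al => h m (comph (p_b d) al)).
  by move=> m al K; rewrite e2 ?eb1 // /K_1 /K_0 K orbT.
pose p := mkh d.+4 d.+4 p13_homo.
have pE i : p i = (if i < 4 then minn i 1 else i) :> nat.
  by rewrite mkhE; have := ltn_ord i; case: ifP; lia.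
have pno m (al : hom m d.+4) l : l < 4 -> l != 0 -> l != 1 -> ~~ has_lett l (im (comph p al)).
  move=> l4 l0 l1; apply/negP => /(has_lettP l4)[i]; rewrite comphE pE.
  by case: ifP; lia.
have pd m (al : hom m d.+4) : K_d (im al) -> K_2 (im (comph p al)).
  case/andP=> c0 _.
  have c0' : ~~ has_lett 0 (im (comph p al)).
    apply/negP => /(has_lettP (isT : 0 < 4))[i]; rewrite comphE pE.
    by have := no_lett i (isT : 0 < 4) c0; case: ifP; lia.
  by apply: K_2_intro => //; apply: pno.
have [||g3 [n3 e32 e3d]] := glue (g2 := fun m al => g2 m (comph p al)) dc2 (@K_d_down d) n2.
- by move=> m n be al /pd K; rewrite -n2 // comphA.
(* On [K_d] the map [p] only moves letter 3 to letter 1. Full simplices of the overlap have no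
   letter 3 and are fixed; the others are in [K_b], where [p_b] does not distinguish letters 1 and
   3. *)
- move=> m al /andP[K2 Kd]; have /andP[c0 c2] := Kd.
  have [fu|nfu] := boolP (full (im al)).
    have c3 := K_2_full K2 Kd fu.
    congr (g2 m _); apply: homP => i; rewrite comphE pE.
    have := no_lett i (isT : 0 < 4) c0; have := no_lett i (isT : 2 < 4) c2.
    by have := no_lett i (isT : 3 < 4) c3; case: ifP; lia.
  have Kb : K_b false (im al) by rewrite /K_b c0 c2 nfu.
  have pp : comph (p_b d) (comph p al) = comph (p_b d) al.
    apply: homP => i; rewrite !comphE !p_bE pE.
    have := no_lett i (isT : 0 < 4) c0; have := no_lett i (isT : 2 < 4) c2.
    by case: ifP; lia.
  have Kb' : K_b false (im (comph p al)).
    apply/and3P; split; last rewrite orbF.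
    - apply/negP => /(has_lettP (isT : 0 < 4))[i]; rewrite comphE pE.
      by have := no_lett i (isT : 0 < 4) c0; case: ifP; lia.
    - exact: pno.
    - have [j j4 h'] := not_full nfu; have jn : j < d.+4.+1 by lia.
      apply/negP => /forallP/(_ (Ordinal jn))/implyP/(_ _)/imP[|i]; first by rewrite /=; lia.
      move/(congr1 (@nat_of_ord _)); rewrite comphE pE /=.
      by have := h' i; case: ifP; lia.
  by rewrite !eb2 ?pp.
have dc3 : down_closed (@K_3 d) := or_down dc2 (@K_d_down d).
have {}n3 : nat_on (@K_3 d) g3 := n3.
have t3 : thin_on (@K_3 d) (@two_letts d) g3.
  move=> m al /orP[K|K] tl; first by rewrite e32 //; apply: t2.
  rewrite e3d //; apply: thin_noninj dc2 n2 (pd _ _ K) _ => alI.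
  have [c1 c3] : has_lett 1 (im al) /\ has_lett 3 (im al).
    case/andP: K tl => c0 c2.
    by rewrite /two_letts (negbTE c0) (negbTE c2) /= orbF => /andP.
  have [i1 e1] := has_lettP (isT : 1 < 4) c1; have [i3 e3] := has_lettP (isT : 3 < 4) c3.
  have e : i1 = i3 by apply: alI; apply: ord_inj; rewrite !comphE !pE e1 e3.
  by move: e1; rewrite e e3.
(* The last horn is on [[013]], at letter 1: its face [[13]] over the full set comes from [K_d], and
   the face it creates is [[03]] over the full set. *)
have [||||||g4 [dc4 n4 t4 e4]] :=
  fill_family Hhorn Hthin (Th := @two_letts d) (k := lett d 1) (a := lett d 0) (F := F_3 d)
    dc3 n3 t3.
- by move=> R c0 c1; apply: (@two_lettsI _ _ 0 1).
- by rewrite !lettK.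
- exact: F_3_bound.
- exact: F_3_horn.
- exact: F_3_face.
- exact: F_3_thin.
have {}n4 : nat_on (@K_4 d) g4 := n4; have {}t4 : thin_on (@K_4 d) (@two_letts d) g4 := t4.
(* Vertices 0 and 1 of the horn are placed at letters 0 and 3, so the filler is the value at the
   face just created. *)
pose em := mkh d.+2 d.+4 emb_homo.
have emE i : em i = (if (i : nat) == 0 then 0 else i + 2) :> nat.
  by rewrite mkhE; have := ltn_ord i; case: ifP; lia.
have em_no m (al : hom m d.+2) l : l < 4 -> l != 0 -> l != 3 -> ~~ has_lett l (im (comph em al)).
  move=> l4 l0 l3; apply/negP => /(has_lettP l4)[i]; rewrite comphE emE.
  by case: ifP; lia.
have K_em m (al : hom m d.+2) : K_4 (im (comph em al)).
  by apply: K_4_intro; apply: em_no.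
have K_em' : K_4 (im em) by have := K_em _ (idh _); rewrite comph_idr.
exists (g4 _ em); split=> m al.
- move=> q; rewrite -n4 //.
  (* Simplices of the horn land in [K_a], where [g4] is still [h] after [p_a], and [p_a] undoes
     [em]. *)
  have Ka : K_a false (im (comph em al)).
    rewrite /K_a em_no // orbF; case/existsP: q => j /andP[j0 jal]; rewrite -negb_and.
    apply/negP => /andP[/(has_lettP (isT : 3 < 4))[i e3] /forallP h'].
    case/negP: jal; apply/imP.
    have [j1|j1] := eqVneq (j : nat) 1.
      exists i; apply: ord_inj; rewrite j1; move: e3; rewrite comphE emE.
      by case: ifP; lia.
    have jn : j + 2 < d.+4.+1 by have := ltn_ord j; lia.
    have /implyP/(_ _)/imP[|i' e'] := h' (Ordinal jn); first by rewrite /=; lia.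
    exists i'; apply: ord_inj; move/(congr1 (@nat_of_ord _)): e'; rewrite comphE emE /=.
    by case: ifP; lia.
  rewrite e4; last by rewrite /K_3 /K_2 /K_1 /K_0 Ka.
  rewrite e32; last by rewrite /K_2 /K_1 /K_0 Ka.
  rewrite ea2 //; congr (h m _); apply: homP => i; rewrite !comphE p_aE emE.
  by case: ifP; lia.
- move=> cov; rewrite -n4 //; apply: t4 => //.
  have hit (j : nat) : j <= 1 -> exists i, al i = j :> nat.
    move=> j1; have jn : j < d.+3 by lia.
    have /imP[i e] := cov (Ordinal jn) j1; exists i; by rewrite e.
  apply: (@two_lettsI _ _ 0 3) => //; apply/imP.
    have [i e] := hit 0 isT; exists i; apply: ord_inj.
    by rewrite comphE emE e lettK.
  have [i e] := hit 1 isT; exists i; apply: ord_inj.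
  by rewrite comphE emE e lettK.
Qed.

(** Letters 1 and 2 with all other vertices form the simplex [S]. Its face without letter 1 is the
    face of [x] opposite to 1, thin by assumption; the others except [S :\ lett d 2] have two
    letters. The thinness extension then gives that one, the face of [x] opposite to 0. *)
Lemma outer_thin_fill d : 0 < d -> thin_fill A d.+2 0.
Proof.
move=> d0 x xt m al [mn alE].
have ndeg m' (be : hom m' d.+2) : covers 0 (im be) -> thin (sact be x).
  by move=> c; apply: xt; left; right=> j /c /imP.
have [g [dc gn gt ea eb]] := @stage1 d true (fun m (al : hom m d.+2) => sact al x)
  (fun m n be al _ => sact_comp _ _ _) (fun m al _ c => ndeg m al c).
pose S : {set 'I_d.+4.+1} := [set j : 'I_d.+4.+1 | ((j : nat) != 0) && ((j : nat) != 3)].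
have cS0 : has_lett 0 S = false by rewrite /has_lett inE lettK.
have cS1 : has_lett 1 S by rewrite /has_lett inE lettK.
have cS2 : has_lett 2 S by rewrite /has_lett inE lettK.
have KS : K_1 true S.
  rewrite /K_1 inE !has_lett_add ?bare_add // cS0 cS1 cS2 /= orbT andbT /K_0 /K_c cS0 andbT.
  by case: (bare S); rewrite ?orbT.
have up_homo : {homo (fun i => if i == 0 then 1 else i + 3) : i j / i <= j}.
  by move=> i j ij; case: ifP; case: ifP; lia.
pose up := mkh d.+1 d.+4 up_homo.
have upE i : up i = (if (i : nat) == 0 then 1 else i + 3) :> nat.
  by rewrite mkhE; have := ltn_ord i; case: ifP; lia.
have upS : im up = S :\ lett d 2.
  apply/setP => j; rewrite !inE; apply/imP/idP => [[i <-]|].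
    rewrite lett_eq // upE; case: ifP; lia.
  rewrite lett_eq // => h; have jn := ltn_ord j.
  have lt : (if (j : nat) == 1 then 0 else j - 3) < d.+2 by case: ifP; lia.
  exists (Ordinal lt); apply: ord_inj; rewrite upE /=.
  have [->|ne] := eqVneq (j : nat) 1 => //=; rewrite (_ : (j - 3 == 0) = false); lia.
have : thin (g _ up).
  apply: (@thin_face A Hthin _ _ _ S (lett d 1) (lett d 2) (lett d 4) dc gn KS) upS.
  - split=> //; first by rewrite inE lettK.
      by rewrite !lettK.
    move=> s; rewrite inE !lettK // => h1 h2; apply: ord_inj; rewrite lettK //; lia.
  (* As [0 < d], vertex 4 is not the last one, so [S] has at least four elements. *)
  - apply: (@four_elements _ S (lett d 1) (lett d 2) (lett d 4) ord_max) => //.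
    + by rewrite /= !inE !lett_inj // ![_ == ord_max]eq_sym !lett_eq //= ?negb_or /=; lia.
    + by rewrite inE lettK.
    + by rewrite inE.
  - move=> m' be beS c1 c2 _; apply: gt; first exact: dc beS KS.
    exact: (@two_lettsI _ _ 1 2).
  - move=> j jS j2 m' be ibe.
    have Kbe : K_1 true (im be) by apply: dc KS; rewrite ibe subD1set.
    have [j1|j1] := eqVneq j (lett d 1); last first.
      apply: gt => //; apply: (@two_lettsI _ _ 1 2) => //; rewrite /has_lett ibe !inE.
        by rewrite eq_sym j1 lettK.
      by rewrite eq_sym j2 lettK.
    subst j.
    have Ka : K_a true (im be) by rewrite /K_a ibe has_lett_del //= !orbT.
    rewrite ea //; apply: (thin_sact_face (i := 1)) => //.
    + by apply: xt; right; exists 1; split=> //; split=> // l; rewrite faceE.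
    + move=> l; rewrite comphE p_aE; have := in_im be l; rewrite ibe !inE lett_eq //; lia.
    + move=> j j1; have jn := ltn_ord j.
      have jlt : j + 2 < d.+4.+1 by lia.
      have : Ordinal jlt \in im be by rewrite ibe !inE lett_eq //=; lia.
      case/imP=> i e; apply/imP; exists i; apply: ord_inj; rewrite comphE p_aE e /=; lia.
rewrite eb; last first.
  by rewrite /K_b upS !has_lett_del // cS0 /= orbT.
suff -> : comph (p_b d) up = face d.+1 0.
  have {}mn : m = d.+1 by lia.
  by subst m; rewrite (_ : face _ _ = al) //; apply: homP => i; rewrite faceE alE.
apply: homP => i; rewrite comphE p_bE upE faceE /bump; case: ifP; lia.
Qed.
End Stages.

(** * Two out of three for thin edges *)

Lemma face_comm n j k : j < k -> k <= n.+2 ->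
  comph (face n.+1 k) (face n j) = comph (face n.+1 j) (face n k.-1).
Proof. by move=> jk kn; apply: homP => i; rewrite !comphE !faceE /bump; lia. Qed.

Lemma dege_face n j : j <= n.+1 -> comph (dege n j) (face n j) = idh n.
Proof.
move=> jn; apply: homP => i; rewrite comphE mkhE faceE idhE.
by have := ltn_ord i; rewrite /bump /unbump; lia.
Qed.

Lemma unbump_lo h i : i <= h -> unbump h i = i.
Proof. by rewrite /unbump ltnNge => ->; rewrite subn0. Qed.

Lemma unbump_hi h i : h < i -> unbump h i = i.-1.
Proof. by rewrite /unbump => ->; rewrite subn1. Qed.

Lemma unbump_comm n j l v : j < l -> l <= n.+2 -> v <= n.+2 -> v <> j -> v <> l ->
  minn (unbump l.-1 (minn (unbump j v) n.+1)) n = minn (unbump j (minn (unbump l v) n.+1)) n.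
Proof.
move=> jl ln vn vj vl; have [lt|ge] := ltnP v j.
  have -> : unbump j v = v by apply: unbump_lo; lia.
  have -> : unbump l v = v by apply: unbump_lo; lia.
  have -> : minn v n.+1 = v by lia.
  by rewrite !unbump_lo //; lia.
have {ge}jv : j < v by lia.
have [lt|ge] := ltnP v l.
  rewrite (@unbump_hi j v) // (@unbump_lo l v); last by lia.
  rewrite (_ : minn v.-1 n.+1 = v.-1); last by lia.
  rewrite (_ : minn v n.+1 = v); last by lia.
  by rewrite unbump_lo ?unbump_hi //; lia.
have {ge}lv : l < v by lia.
rewrite (@unbump_hi j v) // (@unbump_hi l v) //.
rewrite (_ : minn v.-1 n.+1 = v.-1); last by lia.
by rewrite !unbump_hi //; lia.
Qed.

(** A horn simplex is read off [T j] for some vertex [j] that it misses; compatibility of the faces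
    makes the value independent of the choice, which is [key]. *)
Lemma faces_fill (A : strat) n k (T : nat -> A n.+1) :
  horn_fill A n.+2 k -> k <= n.+2 ->
  (forall j l, j < l <= n.+2 -> j <> k -> l <> k ->
     sact (face n l.-1) (T j) = sact (face n j) (T l)) ->
  (forall m (al : hom m n.+2) j, j <= n.+2 -> j <> k -> (forall i, (al i : nat) <> j) ->
     covers k (im al) -> thin (sact (comph (dege n.+1 j) al) (T j))) ->
  exists x : A n.+2,
    (forall j, j <= n.+2 -> j <> k -> sact (face n.+1 j) x = T j) /\
    (forall m (al : hom m n.+2), covers k (im al) -> thin (sact al x)).
Proof.
move=> H kn Tc Tt.
have key m (al : hom m n.+2) j l : j < l -> l <= n.+2 -> j <> k -> l <> k ->
    (forall i, (al i : nat) <> j) -> (forall i, (al i : nat) <> l) ->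
    sact (comph (dege n.+1 j) al) (T j) = sact (comph (dege n.+1 l) al) (T l).
  move=> jl ln jk lk aj al_; have an i := ltn_ord (al i).
  have av1 i : (comph (dege n.+1 j) al i : nat) <> l.-1.
    by rewrite comphE mkhE /unbump; have := aj i; have := al_ i; have := an i; lia.
  have av2 i : (comph (dege n.+1 l) al i : nat) <> j.
    by rewrite comphE mkhE /unbump; have := aj i; have := al_ i; have := an i; lia.
  have l1 : l.-1 <= n.+1 by lia.
  have j1 : j <= n.+1 by lia.
  rewrite -(face_dege l1 av1) -(face_dege j1 av2) !(sact_comp _ (face _ _)).
  rewrite Tc ?jl //; congr sact; apply: homP => i.
  by rewrite !comphE !mkhE; apply: unbump_comm => //; have := an i.
(* Some missed vertex is picked; the default [ord0] is never reached on the horn. *)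
pose h := (fun m al =>
  let j := odflt ord0 [pick j : 'I_n.+3 | ((j : nat) != k) && (j \notin im al)] in
  sact (comph (dege n.+1 j) al) (T j)) : family A n.+2.
have hE m (al : hom m n.+2) j : j <= n.+2 -> j <> k -> (forall i, (al i : nat) <> j) ->
    h m al = sact (comph (dege n.+1 j) al) (T j).
  move=> jn jk aj; rewrite /h; case: pickP => [l /= /andP[/eqP lk lal]|/=]; last first.
    move/(_ (Ordinal (jn : j < n.+3))) => /=; move/eqP: jk => -> /=.
    by move/negbFE/imP => [i e]; case: (aj i); rewrite e.
  have al_ i : (al i : nat) <> l by move/ord_inj => e; rewrite -e in_im in lal.
  have [e|ne] := eqVneq (l : nat) j; first by rewrite e.
  have ln := ltn_ord l.
  have [lt|lt] : l < j \/ j < l by lia.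
    exact: key.
  by symmetry; apply: key.
have missing m (al : hom m n.+2) : hornQ k (im al) ->
    exists j, [/\ j <= n.+2, j <> k & forall i, (al i : nat) <> j].
  case/existsP=> j /andP[/eqP jk jal]; exists (j : nat); split=> //.
    by have := ltn_ord j.
  by move=> i /ord_inj e; rewrite -e in_im in jal.
have [||x [xe xt]] := H h.
- move=> m l be al /missing[j [jn jk aj]].
  rewrite (hE _ al j) // (hE _ _ j) // -?sact_comp ?comphA //.
  by move=> i; rewrite comphE; apply: aj.
- move=> m al /missing[j [jn jk aj]] c; rewrite (hE _ al j) //.
  exact: Tt.
exists x; split=> // j jn jk.
have fj i : (face n.+1 j i : nat) <> j by rewrite faceE /bump; lia.
rewrite xe; first by rewrite (hE _ _ j) // dege_face // sact_id.
apply/existsP; exists (Ordinal (jn : j < n.+3)); rewrite /=; apply/andP; split; first exact/eqP.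
by apply/imP => -[i e]; apply: (fj i); rewrite e.
Qed.

Section Triangles.
Variable A : strat.
Hypothesis Hhorn : forall n k, 0 < k < n -> horn_fill A n k.
Hypothesis Hthin : forall n k, 2 < n -> 0 < k < n -> thin_fill A n k.
Hypothesis spec : thin1_spec A.

Definition tri (f g h : A 1) : Prop := exists T : A 2,
  [/\ thin T, sact (face 1 2) T = f, sact (face 1 0) T = g & sact (face 1 1) T = h].
Definition src (f : A 1) : A 0 := sact (face 0 1) f.
Definition tgt (f : A 1) : A 0 := sact (face 0 0) f.
Definition unit1 (x : A 0) : A 1 := sact (dege 0 0) x.
Definition iso (f : A 1) : Prop :=
  exists f', tri f f' (unit1 (src f)) /\ tri f' f (unit1 (tgt f)).

(** The horn is filled, and the thinness extension in dimension 3 makes the remaining face of the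
    filler thin because the other three are. *)
Lemma tetra k (T : nat -> A 2) : 0 < k < 3 ->
  (forall j l, j < l <= 3 -> j <> k -> l <> k ->
     sact (face 1 l.-1) (T j) = sact (face 1 j) (T l)) ->
  (forall j, j <> k -> thin (T j)) ->
  exists U : A 2, [/\ thin U,
    forall j, j < k -> sact (face 1 j) U = sact (face 1 k.-1) (T j) &
    forall l, k < l <= 3 -> sact (face 1 l.-1) U = sact (face 1 k) (T l)].
Proof.
move=> k3 Tc Tt.
have [||||x [xe xt]] := @faces_fill A 1 k T.
- exact: Hhorn.
- by lia.
- exact: Tc.
(* The range around [k] has three of the four vertices, so [j] is the fourth and [al] hits every
   other vertex. *)
- move=> m al j jn jk aj c; apply: thin_sact_surj; first exact: Tt.
  move=> i; have i2 := ltn_ord i.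
  have lt : bump j i < 4 by rewrite /bump; lia.
  have : Ordinal lt \in im al.
    apply: (c _); rewrite /=; have [jc|jc] := boolP (k.-1 <= j <= k.+1); last first.
      by clear -jc jn k3 i2 jk; rewrite /bump; lia.
    by have /imP[l e] := c (Ordinal (jn : j < 4)) jc; case: (aj l); rewrite e.
  case/imP=> l e; apply/imP; exists l; apply: ord_inj; rewrite comphE mkhE e /=.
  by rewrite /bump /unbump; lia.
exists (sact (face 2 k) x); split.
- apply: (Hthin (n := 3) (k := k)) => //; last by split=> // l; rewrite faceE.
  move=> m al [[/degenerate_noninj|c]|[i [i3 /eqP ik [m2 alE]]]].
  + exact: thin_sact_noninj.
  + by apply: xt => j /c /imP.
  + move: al alE; case: m2 => -> al alE.
    have -> : al = face 2 i by apply: homP => l; rewrite alE faceE.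
    by rewrite xe //; apply: Tt.
- move=> j jk; rewrite -sact_comp face_comm //; last by lia.
  by rewrite sact_comp xe //; lia.
- move=> l kl; rewrite -sact_comp -face_comm; [|lia..].
  by rewrite sact_comp xe //; lia.
Qed.

(** The tetrahedron has edges [a] = 01, [b] = 12, [c] = 02, [e] = 23, [p] = 13, [q] = 03; this lemma
    and [assoc2] recover its faces opposite to 1 and 2. *)
Lemma assoc1 a b c e p q : tri a b c -> tri b e p -> tri a p q -> tri c e q.
Proof.
move=> [T3 [t3 a3 b3 c3]] [T0 [t0 a0 b0 c0]] [T2 [t2 a2 b2 c2]].
(* The entry at index 1 is a placeholder, and the default [T0] is a thin value beyond the list. *)
have [|||U [Ut Uj Ul]] := @tetra 1 (nth T0 [:: T0; T0; T2; T3]) => //.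
- move=> [|[|[|[|j]]]] [|[|[|[|l]]]] //= jl _ _;
    rewrite ?a3 ?b3 ?c3 ?a0 ?b0 ?c0 ?a2 ?b2 ?c2 //; lia.
- by move=> [|[|[|[|[|j]]]]].
by exists U; split=> //; rewrite ?(Ul 3) ?(Ul 2) ?Uj.
Qed.

Lemma assoc2 a b c e p q : tri a b c -> tri b e p -> tri c e q -> tri a p q.
Proof.
move=> [T3 [t3 a3 b3 c3]] [T0 [t0 a0 b0 c0]] [T1 [t1 a1 b1 c1]].
have [|||U [Ut Uj Ul]] := @tetra 2 (nth T0 [:: T0; T1; T0; T3]) => //.
- move=> [|[|[|[|j]]]] [|[|[|[|l]]]] //= jl _ _;
    rewrite ?a3 ?b3 ?c3 ?a0 ?b0 ?c0 ?a1 ?b1 ?c1 //; lia.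
- by move=> [|[|[|[|[|j]]]]].
by exists U; split=> //; rewrite ?(Ul 3) ?Uj.
Qed.

Lemma tri_src f g h : tri f g h -> src h = src f.
Proof. by move=> [T [_ <- _ <-]]; rewrite /src -!sact_comp (@face_comm 0 1 2). Qed.

Lemma tri_tgt f g h : tri f g h -> tgt h = tgt g.
Proof. by move=> [T [_ _ <- <-]]; rewrite /tgt -!sact_comp (@face_comm 0 0 1). Qed.

Lemma tri_mid f g h : tri f g h -> tgt f = src g.
Proof. by move=> [T [_ <- <- _]]; rewrite /tgt /src -!sact_comp (@face_comm 0 0 2). Qed.

Lemma tgt_unit x : tgt (unit1 x) = x.
Proof.
rewrite /tgt /unit1 -sact_comp (_ : comph _ _ = idh 0) ?sact_id //.
by apply: homP => i; rewrite !ord1.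
Qed.

Lemma unitl g : tri (unit1 (src g)) g g.
Proof.
exists (sact (dege 1 0) g); split.
- by apply: thin_degen; exists 1, (dege 1 0), g.
- rewrite /unit1 /src -!sact_comp; congr sact; apply: homP => i.
  by rewrite !comphE !mkhE /bump /unbump; have := ltn_ord i; lia.
- by rewrite -sact_comp dege_face ?sact_id.
- rewrite -sact_comp (_ : comph _ _ = idh 1) ?sact_id //; apply: homP => i.
  by rewrite comphE idhE !mkhE /bump /unbump; have := ltn_ord i; lia.
Qed.

Lemma tri_comp f g : tgt f = src g -> exists h, tri f g h.
Proof.
move=> fg; have [||||x [xe xt]] := @faces_fill A 0 1 (nth f [:: g; g; f]).
- exact: Hhorn.
- by [].
- by move=> [|[|[|j]]] [|[|[|l]]] //; lia.
- move=> m al j jn _ aj c; have : inord j \in im al by apply: c; rewrite inordK; lia.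
  by case/imP=> i /(congr1 (@nat_of_ord _)); rewrite inordK // => /aj.
exists (sact (face 1 1) x), x; split=> //; rewrite ?xe //.
by rewrite -(sact_id x); apply: xt => j _; apply/imP; exists j; rewrite idhE.
Qed.

(** Since [g'] undoes [g], following [g] by [k] gives [f']; associativity with [f] concludes. *)
Lemma tri_inv f f' g g' h k a : tri f g h -> tri g' f' k -> tri f f' a ->
  tri g g' (unit1 (src f')) -> tri h k a.
Proof.
move=> fg gf ff gg; apply: (assoc1 fg) ff.
exact: assoc2 gg gf (unitl f').
Qed.

Lemma iso_comp f g h : tri f g h -> iso f -> iso g -> iso h.
Proof.
move=> fgh [f' [ff' f'f]] [g' [gg' g'g]].
have e1 := tri_mid fgh; have e2 := tri_mid ff'; have e3 := tri_tgt gg'.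
have e4 := tri_mid g'g; have e5 := tri_mid gg'.
rewrite tgt_unit in e3.
have [|k g'f'k] := @tri_comp g' f'; first by rewrite -e3 -e1.
exists k; rewrite (tri_src fgh) (tri_tgt fgh); split.
- by apply: tri_inv fgh g'f'k ff' _; rewrite -e2 e1.
- by apply: tri_inv g'f'k fgh g'g _; rewrite -e1.
Qed.

Lemma iso_inv f f' : tri f f' (unit1 (src f)) -> tri f' f (unit1 (tgt f)) -> iso f'.
Proof.
move=> ff' f'f; exists f; split.
- by rewrite -(tri_mid ff').
- by have := tri_tgt ff'; rewrite tgt_unit => <-.
Qed.

Lemma iso_div f g h : tri f g h -> iso f -> iso h -> iso g.
Proof.
move=> fgh [f' [ff' f'f]] hi; apply: (iso_comp _ (iso_inv ff' f'f) hi).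
by have e := tri_mid fgh; apply: assoc2 f'f fgh _; rewrite e; apply: unitl.
Qed.

Lemma thin_iso v : thin v -> iso v.
Proof.
move=> /(thin1_E2_map spec)[F [[Fn Ft] Fv]].
have F0 m n (al : hom m n) w : inE2 w -> sact al (F n w) = F m (sact al w) by move=> ?; rewrite Fn.
have Em : inE2 w_mpm by exists (idh 2); left; rewrite sact_id.
have Ep : inE2 w_pmp by exists (idh 2); right; rewrite sact_id.
have E1 := inE2_e1m.
have i2 (i : 'I_2) : (i : nat) = 0 \/ (i : nat) = 1 by have := ltn_ord i; lia.
have EnegE m (w : E m) i : Eneg w i = ~~ (w : {ffun _}) i by rewrite ffunE.
pose sim := (EactE, w_mpmE, w_pmpE, e1mE, EnegE, faceE, mkhE).
exists (F 1 (Eneg e1m)); split; [exists (F 2 w_mpm) | exists (F 2 w_pmp)]; split;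
  try (exact: Ft); rewrite -?Fv /unit1 /src /tgt ?F0 //; try (exact: inE2_sact);
  congr (F 1 _); apply/ffunP => i; rewrite !sim;
  by case: (i2 i) => e; rewrite ?e.
Qed.

Lemma hom0_eq m (a b : hom m 0) : a = b.
Proof. by apply: homP => i; rewrite !ord1. Qed.

(** The triangles [T] and [U] prescribe the images of [-+-] and [+-+]. A word can be presented in
    several ways, through one generator or both, so [same] and [cross] show that the value depends
    on the word alone. *)
Lemma iso_thin v : iso v -> thin v.
Proof.
move=> [v' [[T [Tt T2 T0 T1]] [U [Ut U2 U0 U1]]]].
have mid : tgt v = src v' by apply: (@tri_mid _ _ (unit1 (src v))); exists T.
(* If vertex 1 is hit, the word determines the operator; if not, the operator lands in the face
   opposite to 1, which is a unit. *)
have same m (X : A 2) x (al be : hom m 2) : sact (face 1 1) X = unit1 x ->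
    (forall i, ((al i : nat) == 1) = ((be i : nat) == 1)) -> sact al X = sact be X.
  move=> X1 e; have [/existsP[i /eqP ali]|/existsPn no] := boolP [exists i, (al i : nat) == 1].
    congr sact; apply: homP => l; have := e l; have bei : (be i : nat) = 1.
      by have := e i; rewrite ali eqxx => /esym/eqP.
    have := ltn_ord (al l); have := ltn_ord (be l).
    by case: (hom_le2 al be l i); lia.
  have na i : (al i : nat) <> 1 by apply/eqP.
  have nb i : (be i : nat) <> 1 by have := no i; rewrite e => /eqP.
  rewrite -(face_dege (isT : 1 <= 2) na) -(face_dege (isT : 1 <= 2) nb).
  by rewrite !(sact_comp _ (face _ _)) X1 /unit1 -!sact_comp; congr sact; apply: hom0_eq.
have konst m (X Y : A 2) (al be : hom m 2) :
    sact (face 1 1) X = unit1 (src (sact (face 1 0) Y)) ->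
    (forall i, (al i : nat) <> 1) -> (forall i, (be i : nat) = 1) -> sact al X = sact be Y.
  move=> X1 na nb; have nb0 i : (be i : nat) <> 0 by rewrite nb.
  rewrite -(face_dege (isT : 1 <= 2) na) -(face_dege (isT : 0 <= 2) nb0).
  rewrite !(sact_comp _ (face _ _)) X1 /unit1 /src -!sact_comp; congr sact; apply: homP => i.
  by rewrite !comphE !mkhE nb /unbump /bump /=; lia.
have cross m (al be : hom m 2) : (forall i, ((al i : nat) == 1) = ((be i : nat) != 1)) ->
    sact al T = sact be U.
  move=> e.
  have [/existsP[i /eqP ali]|/existsPn no] := boolP [exists i, (al i : nat) == 1]; last first.
    apply: konst; first by rewrite T1 U0.
      by move=> i; apply/eqP.
    by move=> i; have := no i; rewrite e negbK => /eqP.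
  have [/existsP[j /eqP bej]|/existsPn no] := boolP [exists i, (be i : nat) == 1]; last first.
    symmetry; apply: konst; first by rewrite U1 T0 mid.
      by move=> l; apply/eqP.
    by move=> l; have := no l; rewrite -e => /eqP.
  have alj := e j; rewrite bej eqxx /= in alj.
  have al3 l := ltn_ord (al l); have be3 l := ltn_ord (be l).
  (* Both signs occur. If [i] comes first the word is [+-], with repetitions, and lies on the shared
     edge [v']; otherwise it is [-+], on the shared edge [v]. *)
  have [ij|ij] := leqP i j.
    have {}alj : (al j : nat) = 2 by have := hom_le al ij; have := al3 j; lia.
    have bei : (be i : nat) = 0 by have := hom_le be ij; have := e i; lia.
    have al0 l : (al l : nat) <> 0.
      have := e l; have := al3 l; have := be3 l.
      by case: (hom_le2 al be l i); lia.
    have eb : be = comph (face 1 2) (comph (dege 1 0) al).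
      apply: homP => l; rewrite !comphE faceE mkhE /bump /unbump.
      have := e l; have := al3 l; have := be3 l; have := al0 l.
      by case: (hom_le2 al be l j); lia.
    by rewrite -(face_dege (isT : 0 <= 2) al0) eb !(sact_comp _ (face _ _)) T0 U2.
  have {}alj : (al j : nat) = 0 by have := hom_le al (ltnW ij); lia.
  have bei : (be i : nat) = 2 by have := hom_le be (ltnW ij); have := be3 i; have := e i; lia.
  have al2 l : (al l : nat) <> 2.
    have := e l; have := al3 l; have := be3 l.
    by case: (hom_le2 al be l i); lia.
  have eb : be = comph (face 1 0) (comph (dege 1 2) al).
    apply: homP => l; rewrite !comphE faceE mkhE /bump /unbump.
    have := e l; have := al3 l; have := be3 l; have := al2 l.
    by case: (hom_le2 al be l j); lia.
  by rewrite -(face_dege (isT : 2 <= 2) al2) eb !(sact_comp _ (face _ _)) T2 U0.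
pose R m (w : E m) (y : A m) := exists al : hom m 2,
  (w = sact al w_mpm /\ y = sact al T) \/ (w = sact al w_pmp /\ y = sact al U).
have Runiq m (w : E m) y y' : R m w y -> R m w y' -> y = y'.
  have pt (al be : hom m 2) (x x' : E 2) : sact al x = sact be x' ->
      forall i, (x : {ffun _}) (al i) = (x' : {ffun _}) (be i).
    by move=> /ffunP e i; have := e i; rewrite !EactE.
  move=> [al [] [-> ->]] [be [] [/pt e ->]].
  - by apply: (same _ _ _ _ _ T1) => i; have := e i; rewrite !w_mpmE.
  - by apply: cross => i; have := e i; rewrite w_mpmE w_pmpE.
  - symmetry; apply: cross => i; have := e i; rewrite w_mpmE w_pmpE => <-; by rewrite ?negbK.
  - by apply: (same _ _ _ _ _ U1) => i; have := e i; rewrite !w_pmpE => /negb_inj.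
have Rex m (w : E m) : inE2 w -> exists y, R m w y.
  by move=> [al [->|->]]; [exists (sact al T)|exists (sact al U)]; exists al; [left|right].
pose F m (w : E m) (p : inE2 w) := proj1_sig (constructive_indefinite_description _ (Rex m w p)).
have FR m w p : R m w (F m w p) by exact: proj2_sig (constructive_indefinite_description _ _).
have Fn : pnatural F.
  move=> m n al w p q; apply: Runiq (FR _ _ q) _.
  have [be [[e ->]|[e ->]]] := FR _ _ p; exists (comph be al); [left|right];
    by rewrite !sact_comp -e.
have i2 (i : 'I_2) : (i : nat) = 0 \/ (i : nat) = 1 by have := ltn_ord i; lia.
apply/spec; exists F; split=> //.
- move=> m w p [m1|[l [al [y [lm yE e]]]]]; last first.
    subst w; apply: thin_degen; exists l, al, (F l y yE); split=> //; exact: Fn.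
  have thin2 (X : A 2) (al : hom m 2) : thin X -> thin (sact al X).
    move=> Xt; case: (excluded_middle_informative (injective al)) => [alI|]; last first.
      exact: thin_sact_noninj.
    have m2 : m = 2.
      by have := max_card (im al); rewrite injectiveE // card_ord; lia.
    by subst m; rewrite (inj_endo_id alI) sact_id.
  by have [be [[_ ->]|[_ ->]]] := FR _ _ p; apply: thin2.
- exists inE2_e1m; apply: Runiq (FR _ _ _) _; exists (face 1 2); left.
  by split; rewrite ?T2 //; apply/ffunP => i; rewrite EactE e1mE w_mpmE faceE; case: (i2 i) => ->.
Qed.

(** For [k = 1] isomorphisms compose, which supplies the one inner extension not assumed; for
    [k = 0] they cancel. *)
Lemma thin_fill_2 k : k < 2 -> thin_fill A 2 k.
Proof.
move=> k2 x xt.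
have t2 : thin x.
  by rewrite -(sact_id x); apply: xt; left; right=> j _; exists j; rewrite idhE.
have tf i : i <= 2 -> i != k -> thin (sact (face 1 i) x).
  by move=> i2 ik; apply: xt; right; exists i; split=> //; split=> // l; rewrite faceE.
have tr : tri (sact (face 1 2) x) (sact (face 1 0) x) (sact (face 1 1) x) by exists x.
move=> m al [/succn_inj m1 alE]; subst m.
have -> : al = face 1 k by apply: homP => l; rewrite alE faceE.
apply: iso_thin; case: k k2 tf {xt alE} => [|[|//]] _ tf.
- by apply: iso_div tr _ _; apply: thin_iso; apply: tf.
- by apply: iso_comp tr _ _; apply: thin_iso; apply: tf.
Qed.
End Triangles.

(** * Opposites *)

Lemma oph_subproof m n (al : hom m n) : monob [ffun i => rev_ord (al (rev_ord i))].
Proof.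
apply/forallP => i; apply/forallP => j; apply/implyP => ij; rewrite !ffunE.
have h : rev_ord j <= rev_ord i by rewrite /=; lia.
by have := hom_le al h; rewrite /=; lia.
Qed.

Definition oph m n (al : hom m n) : hom m n := Hom (oph_subproof al).

Lemma ophE m n (al : hom m n) i : oph al i = rev_ord (al (rev_ord i)).
Proof. by rewrite /= ffunE. Qed.

Lemma ophK m n (al : hom m n) : oph (oph al) = al.
Proof. by apply: homP => i; rewrite !ophE !rev_ordK. Qed.

Lemma oph_id n : oph (idh n) = idh n.
Proof. by apply: homP => i; rewrite ophE !idhE rev_ordK. Qed.

Lemma oph_comp l m n (b : hom m n) (a : hom l m) : oph (comph b a) = comph (oph b) (oph a).
Proof. by apply: homP => i; rewrite !comphE !ophE comphE rev_ordK. Qed.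

Lemma im_oph m n (al : hom m n) j : (j \in im (oph al)) = (rev_ord j \in im al).
Proof.
apply/imP/imP => -[i e]; exists (rev_ord i); first by rewrite -e ophE rev_ordK.
by rewrite ophE rev_ordK e rev_ordK.
Qed.

Section Opposite.
Variable A : strat.

Lemma op_act_id n (x : A n) : sact (oph (idh n)) x = x.
Proof. by rewrite oph_id sact_id. Qed.

Lemma op_act_comp l m n (a : hom l m) (b : hom m n) (x : A n) :
  sact (oph (comph b a)) x = sact (oph a) (sact (oph b) x).
Proof. by rewrite oph_comp sact_comp. Qed.

Definition op_sset : sset :=
  @SSet (fun n => A n) (fun m n al x => sact (oph al) x) op_act_id op_act_comp.

Lemma op_thin_degen n (x : op_sset n) : degenerate x -> thin (x : A n).
Proof. by move=> [m [al [y [lt ->]]]]; apply: thin_degen; exists m, (oph al), y. Qed.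

Definition op_strat : strat :=
  @Strat op_sset (fun n x => thin (x : A n)) op_thin_degen (@thin0 A).
End Opposite.

Lemma hornQ_oph n k m (al : hom m n) : k <= n ->
  hornQ (n - k) (im (oph al)) -> hornQ k (im al).
Proof.
move=> kn /existsP[j /andP[jk jal]]; apply/existsP; exists (rev_ord j).
by rewrite -im_oph jal andbT /=; have := ltn_ord j; lia.
Qed.

Lemma covers_oph n k m (al : hom m n) : k <= n ->
  covers k (im al) -> covers (n - k) (im (oph al)).
Proof.
move=> kn c j jk; rewrite im_oph; apply: c => /=; have := ltn_ord j; lia.
Qed.

Lemma isface_oph n i m (al : hom m n) : i <= n -> isface i al -> isface (n - i) (oph al).
Proof.
move=> le_in [mn alE]; split=> // l; rewrite ophE /= alE /= /bump.
by have := ltn_ord l; lia.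
Qed.

Lemma horn_fill_op (A : strat) n k : k <= n -> horn_fill A n k -> horn_fill (op_strat A) n (n - k).
Proof.
move=> kn H h hn ht; have kn' : n - (n - k) = k by lia.
have Q m (al : hom m n) : hornQ k (im al) -> hornQ (n - k) (im (oph al)).
  by rewrite -{1}(ophK al) -{1}kn'; apply: hornQ_oph; lia.
have C m (al : hom m n) : covers (n - k) (im (oph al)) -> covers k (im al).
  by move=> c; rewrite -(ophK al) -kn'; apply: covers_oph => //; lia.
have [||x [xe xt]] := H (fun m al => h m (oph al) : A m).
- by move=> m l be al q; rewrite oph_comp hn ?Q //= ophK.
- by move=> m al /Q q c; apply: ht => //; apply: covers_oph.
exists x; split=> m al q /=.
- by rewrite xe ?ophK //; apply: (hornQ_oph kn); rewrite ophK.
- by apply: xt; apply: C; rewrite ophK.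
Qed.

Lemma thin_fill_op (A : strat) n k : k <= n -> thin_fill A n k -> thin_fill (op_strat A) n (n - k).
Proof.
move=> kn H x xt m al alf; have kn' : n - (n - k) = k by lia.
apply: (H x); last by rewrite -kn'; apply: isface_oph => //; lia.
move=> {alf al}m al alt; rewrite -(ophK al); apply: (xt m (oph al)).
case: alt => [[[l [be [y [lm e]]]]|c]|[i [i_n ik alf]]].
- by left; left; exists l, (oph be), (oph y); split=> //; rewrite e /= oph_comp.
- left; right; move=> j jk; apply/imP; move: jk; apply: covers_oph => // i /c /imP //.
- by right; exists (n - i); split; [lia|lia|apply: isface_oph].
Qed.

(** The double opposite acts by [oph (oph al)], equal but not convertible to [al], so the passage
    back needs an argument. *)
Lemma horn_fill_opK (A : strat) n k : horn_fill (op_strat (op_strat A)) n k -> horn_fill A n k.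
Proof.
move=> H h hn ht; have [|x [xe xt]] := H (h : family (op_strat (op_strat A)) n) _ ht.
  by move=> m l be al q; rewrite hn //= ophK.
by exists x; split=> m al q; [rewrite -xe|have := xt _ _ q]; rewrite //= ophK.
Qed.

Lemma thin_fill_opK (A : strat) n k : thin_fill (op_strat (op_strat A)) n k -> thin_fill A n k.
Proof.
move=> H x xt m al alf; rewrite -(ophK al); apply: (H x) alf.
by move=> m' be h; rewrite /= ophK; apply: xt.
Qed.

(** Reversal alone turns [-+] into [+-]; exchanging the signs as well keeps [e1m] fixed and swaps
    the two generators. *)
Definition Erev m (w : E m) : E m := [ffun i => ~~ (w : {ffun _}) (rev_ord i)].

Lemma Erev_sact m n (al : hom m n) (w : E n) : Erev (sact al w) = sact (oph al) (Erev w).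
Proof. by apply/ffunP => i; rewrite EactE [LHS]ffunE [RHS]ffunE EactE ophE rev_ordK. Qed.

Lemma Erev_mpm : Erev w_mpm = w_pmp.
Proof. by apply/ffunP => -[[|[|[|//]]] lt]; rewrite [LHS]ffunE w_mpmE w_pmpE. Qed.

Lemma Erev_pmp : Erev w_pmp = w_mpm.
Proof. by apply/ffunP => -[[|[|[|//]]] lt]; rewrite [LHS]ffunE w_mpmE w_pmpE. Qed.

Lemma Erev_e1m : Erev e1m = e1m.
Proof. by apply/ffunP => -[[|[|//]] lt]; rewrite [LHS]ffunE !e1mE. Qed.

Lemma inE2_rev m (w : E m) : inE2 w -> inE2 (Erev w).
Proof.
by move=> [al [->|->]]; exists (oph al); rewrite Erev_sact ?Erev_mpm ?Erev_pmp; [right|left].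
Qed.

Lemma E2_edge_op (A : strat) (v : A 1) : E2_edge v -> E2_edge (v : op_strat A 1).
Proof.
move=> [f [fn ft [p fp]]].
exists (fun m w q => f m (Erev w) (inE2_rev q)); split.
- move=> m n al w q r; move: (inE2_rev r); rewrite Erev_sact => r'; exact: fn.
- move=> m w q wt; apply: ft; case: wt => [|[l [al [y [lm yE ->]]]]]; [by left|right].
  by exists l, (oph al), (Erev y); split=> //; [apply: inE2_rev|rewrite Erev_sact].
- exists p; move: (inE2_rev p); rewrite Erev_e1m => p'; rewrite -fp; congr f.
  exact: Classical_Prop.proof_irrelevance.
Qed.

Lemma thin1_spec_op (A : strat) : thin1_spec A -> thin1_spec (op_strat A).
Proof.
move=> spec v; split=> [/spec/E2_edge_op //|/E2_edge_op[f [fn ft fp]]].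
apply/spec; exists f; split=> // m n al w p q.
by rewrite (fn _ _ _ _ p) /= ophK.
Qed.

(** * Assembly by duality *)

Lemma horn_fill_1 (A : strat) : horn_fill A 1 0.
Proof.
move=> h hn ht; pose c := mkh 0 1 (const_homo 0).
have cE i : (c i : nat) = 0 by rewrite mkhE.
have Q0 : hornQ 0 (im c) by apply: (@horn_missing _ _ _ 1) => // i; rewrite cE.
(* The horn is the vertex 0, and the degenerate edge on it is a thin filler. *)
exists (sact (dege 0 0) (h 0 c)); split=> m al.
  case/existsP=> j /andP[j0 jal]; rewrite -sact_comp -hn //; congr (h m _).
  apply: homP => i; rewrite comphE cE; have := ltn_ord (al i); have := ltn_ord j.
  have : (al i : nat) <> j by move/ord_inj => e; rewrite -e in_im in jal.
  lia.
move=> cov; apply: thin_sact_surj; first by apply: thin_degen; exists 0, (dege 0 0), (h 0 c).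
by move=> j; apply: cov; have := ltn_ord j; lia.
Qed.

Lemma outer_fill (A : strat) :
  (forall n k, 0 < k < n -> horn_fill A n k) ->
  (forall n k, 2 < n -> 0 < k < n -> thin_fill A n k) -> thin1_spec A ->
  (forall n, 0 < n -> horn_fill A n 0) /\ (forall n, 1 < n -> thin_fill A n 0).
Proof.
move=> Hh Ht spec; split=> [[|[|n]]|[|[|[|n]]]] // _.
- exact: horn_fill_1.
- exact: outer_horn_fill.
- exact: thin_fill_2.
- exact: outer_thin_fill.
Qed.

Theorem mainTheorem8 (A : strat)
  (Hhorn : forall n k, 0 < k < n -> rlp_horn A n k)
  (Hthin : forall n k, 2 <= n -> 0 < k < n -> (n, k) <> (2, 1) -> rlp_thin A n k)
  (Hthin1 : forall v : A 1,
      thin v <->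
      exists f : forall m (w : E m), inE2 w -> A m,
        [/\ pnatural f,
            (forall m (w : E m) (p : inE2 w), thin_th1E2 w -> thin (f m w p)) &
            exists p : inE2 e1m, f 1 e1m p = v]) :
  weak_complicial A.
Proof.
have Hh n k : 0 < k < n -> horn_fill A n k by move=> kn; apply: horn_fill_rlp; apply: Hhorn.
have Ht n k : 2 < n -> 0 < k < n -> thin_fill A n k.
  move=> n2 kn; apply: thin_fill_rlp; first by lia.
  by apply: Hthin => // [|[]]; lia.
have [H0 T0] := outer_fill Hh Ht Hthin1.
(* The extensions at [k = n] are those at 0 for the opposite, which exchanges inner [k] and
   [n - k]. *)
have [||Hn Tn] := outer_fill _ _ (thin1_spec_op Hthin1).
- move=> n k kn; rewrite (_ : k = n - (n - k)); last by lia.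
  by apply: horn_fill_op; [|apply: Hh]; lia.
- move=> n k n2 kn; rewrite (_ : k = n - (n - k)); last by lia.
  by apply: thin_fill_op; [|apply: Ht]; lia.
have Hnn n : 0 < n -> horn_fill A n n.
  by move=> n0; apply: horn_fill_opK; rewrite -{2}[n]subn0; apply: horn_fill_op (Hn n n0).
have Tnn n : 1 < n -> thin_fill A n n.
  by move=> n0; apply: thin_fill_opK; rewrite -{2}[n]subn0; apply: thin_fill_op (Tn n n0).
split=> n k n0 kn.
- apply: rlp_horn_fill => //; have [->|k0] := posnP k; first exact: H0.
  by have [->|ne] := eqVneq k n; [apply: Hnn|apply: Hh; lia].
- apply: rlp_thin_fill; have [->|k0] := posnP k; first exact: T0.
  have [->|ne] := eqVneq k n; first exact: Tnn.
  have [n2|n2] := ltnP 2 n; first by apply: Ht; lia.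
  (* What remains is [n = 2], [k = 1], the inner thinness extension left out of the hypotheses. *)
  have -> : n = 2 by lia.
  by apply: thin_fill_2 => //; lia.
Qed.
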